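(* Let $N\ge 1$, let $k_\omega>0$ and $k_v>0$ be arbitrary constants, and suppose that Assumptions 1, 2 and 3 (stated in the context) hold. Let $H=[h_{ij}]\in\mathbb{R}^{N\times N}$ be given by $h_{ij}=-a_{ij}$ for $i\ne j$ and $h_{ii}=\sum_{j=0}^N a_{ij}$. Then the origin of the time-varying system on $\mathbb{R}^{3N}$ $$\dot{\bar\theta}=-k_\omega H\bar\theta,$$ $$\dot{\bar x}=-k_vH\bar x+\omega_0(t)\bar y-k_\omega\tilde y_0(t)H\bar\theta-k_\omega\,\mathrm{diag}(\bar y)H\bar\theta,$$ $$\dot{\bar y}=-\omega_0(t)\bar x+k_\omega\tilde x_0(t)H\bar\theta+k_\omega\,\mathrm{diag}(\bar x)H\bar\theta$$ is globally $\mathcal{K}$-exponentially stable, in the following sense: there exist a class $\mathcal{K}$ function $M_0(\cdot)$ and a constant $C_3>0$ (independent of the initial state) such that for every initial time $t_0\ge0$ and every initial state, with $r_0:=\|[\bar x^{\mathsf T}(t_0),\bar y^{\mathsf T}(t_0),\bar\theta^{\mathsf T}(t_0)]\|$, the solution satisfies $$\|[\bar x^{\mathsf T}(t),\bar y^{\mathsf T}(t),\bar\theta^{\mathsf T}(t)]\|\le M_0(r_0)\,e^{-C_3(t-t_0)}\qquad\text{for all }t\ge t_0.$$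
   Context: Leader robot (index $0$): $\dot x_0=v_0(t)\cos\theta_0$, $\dot y_0=v_0(t)\sin\theta_0$, $\dot\theta_0=\omega_0(t)$, where $v_0(t),\omega_0(t)$ are given time-varying functions and $(x_0,y_0,\theta_0)$ is a given solution defined for $t\ge0$. Set $\tilde x_0=x_0\cos\theta_0+y_0\sin\theta_0$ and $\tilde y_0=-x_0\sin\theta_0+y_0\cos\theta_0$. Communication network: a directed graph $\bar{\mathcal G}=(\bar{\mathcal V},\bar{\mathcal E})$ with $\bar{\mathcal V}=\{0,1,\dots,N\}$ ($0$ is the leader, $1,\dots,N$ the followers); an edge $(j,i)\in\bar{\mathcal E}$ means robot $i$ can receive information from robot $j$. The weights $a_{ij}\ge0$ ($i=1,\dots,N$, $j=0,\dots,N$) satisfy $a_{ii}=0$ and, for $i\neq j$, $a_{ij}>0$ if and only if $(j,i)\in\bar{\mathcal E}$. For $\xi\in\mathbb{R}^N$, $\mathrm{diag}(\xi)$ is the diagonal matrix with diagonal entries $\xi_1,\dots,\xi_N$. $\|\cdot\|$ is the Euclidean norm. A class $\mathcal{K}$ function is a continuous strictly increasing function $\alpha:[0,\infty)\to[0,\infty)$ with $\alpha(0)=0$. The variables $\bar\theta,\bar x,\bar y\in\mathbb{R}^N$ are the tracking errors of the $N$ followers in transformed coordinates. Assumption 1: there is $M>0$ with $|x_0(t)|\le M$ and $|y_0(t)|\le M$ for all $t\ge0$. Assumption 2: $\omega_0$ is differentiable and there is $\bar\omega>0$ with $|\omega_0(t)|\le\bar\omega$ and $|\dot\omega_0(t)|\le\bar\omega$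 for all $t\ge0$; moreover there are $T>0$ and $\mu>0$ with $\int_t^{t+T}\omega_0^2(\tau)\,d\tau\ge\mu$ for all $t\ge0$. Assumption 3: $\bar{\mathcal G}$ contains a directed spanning tree with node $0$ as its root. *)

(* Defs.v *)
From HB Require Import structures.
From mathcomp Require Import all_boot all_order all_algebra.
From mathcomp Require Import all_classical all_reals all_analysis.
Set Implicit Arguments.
Unset Strict Implicit.
Unset Printing Implicit Defensive.
Import Order.TTheory GRing.Theory Num.Theory.
Import numFieldNormedType.Exports.
Local Open Scope classical_set_scope.
Local Open Scope ring_scope.

Section Dynamics.
Context {R : realType}.

(* [f] has derivative [l] at [t] as a function on [a, +oo[: the usual two-sided
   derivative when a < t, the right derivative when t = a. The values of [f] on
   the left of [a] are irrelevant. *)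
Definition is_derive_from (a : R) (f : R -> R) (t l : R) : Prop :=
  (fun h : R => h^-1 * (f (t + h) - f t))
    @ within [set h : R | a <= t + h] (0 : R)^' --> l.

Definition enorm {n : nat} (v : 'cV[R]_n) : R :=
  Num.sqrt (\sum_(i < n) v i 0 ^+ 2).

Definition class_K (alpha : R -> R) : Prop :=
  [/\ alpha 0 = 0,
      {within `[0, +oo[, continuous alpha} &
      forall r s : R, 0 <= r -> r < s -> alpha r < alpha s].

Definition is_solution {n : nat} (f : R -> 'cV[R]_n -> 'cV[R]_n) (t0 : R)
    (z0 : 'cV[R]_n) (z : R -> 'cV[R]_n) : Prop :=
  z t0 = z0 /\
  forall t : R, t0 <= t -> forall i : 'I_n,
    is_derive_from t0 (fun s => z s i 0) t (f t (z t) i 0).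

(* The stability of the origin of z' = f t z. The existence clause rules out
   finite escape times, so that the bound on [t0, +oo[ is never vacuous. *)
Definition globally_K_exponentially_stable {n : nat}
    (f : R -> 'cV[R]_n -> 'cV[R]_n) : Prop :=
  exists (M0 : R -> R) (C3 : R),
    [/\ class_K M0, 0 < C3 &
      forall (t0 : R) (z0 : 'cV[R]_n), 0 <= t0 ->
        (exists z : R -> 'cV[R]_n, is_solution f t0 z0 z) /\
        (forall z : R -> 'cV[R]_n, is_solution f t0 z0 z ->
           forall t : R, t0 <= t ->
             enorm (z t) <= M0 (enorm z0) * expR (- C3 * (t - t0)))].

Definition leader_dynamics (v0 omega0 x0 y0 theta0 : R -> R) : Prop :=
  forall t : R, 0 <= t ->
    [/\ is_derive_from 0 x0 t (v0 t * cos (theta0 t)),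
        is_derive_from 0 y0 t (v0 t * sin (theta0 t)) &
        is_derive_from 0 theta0 t (omega0 t)].

Definition bounded_position (x0 y0 : R -> R) : Prop :=
  exists2 M : R, 0 < M &
    forall t : R, 0 <= t -> `|x0 t| <= M /\ `|y0 t| <= M.

Definition bounded_exciting (omega0 : R -> R) : Prop :=
  (exists2 wbar : R, 0 < wbar &
     forall t : R, 0 <= t ->
       `|omega0 t| <= wbar /\
       exists2 dw : R, is_derive_from 0 omega0 t dw & `|dw| <= wbar) /\
  (exists T mu : R,
     [/\ 0 < T, 0 < mu &
       forall t : R, 0 <= t ->
         (mu%:E <= \int[lebesgue_measure]_(tau in `[t, (t + T)%R])
                     ((omega0 tau ^+ 2)%:E))%E]).

End Dynamics.

Section Graph.

(* [t] is a directed tree with root [r], on all vertices, contained in [e];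
   [e u v] stands for the edge (u, v) from [u] to [v]. *)
Definition directed_spanning_tree {V : finType} (e t : rel V) (r : V) : Prop :=
  [/\ subrel t e,
      forall u : V, ~~ t u r,
      forall v : V, v != r -> exists! u : V, t u v &
      forall v : V, connect t r v].

Definition has_spanning_tree_rooted_at {V : finType} (e : rel V) (r : V) :
    Prop :=
  exists t : rel V, directed_spanning_tree e t r.

End Graph.

Section Network.
Context {R : realType} {N : nat}.

(* The nodes are 'I_N.+1, with the leader at [ord0]; 'I_N indexes the followers,
   and row [i] of the weights belongs to node [follower i]. *)
Definition follower (i : 'I_N) : 'I_N.+1 := lift ord0 i.

Definition adapted_weights (e : rel 'I_N.+1) (a : 'M[R]_(N, N.+1)) : Prop :=
  forall (i : 'I_N) (j : 'I_N.+1),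
    [/\ 0 <= a i j,
        j = follower i -> a i j = 0 &
        j <> follower i -> (0 < a i j <-> e j (follower i))].

Definition Hmx (a : 'M[R]_(N, N.+1)) : 'M[R]_N :=
  \matrix_(i < N, j < N)
    (if i == j then \sum_(k < N.+1) a i k else - a i (follower j)).

Definition cdiag (xi : 'cV[R]_N) : 'M[R]_N := diag_mx xi^T.

Definition xtilde (x0 y0 theta0 : R -> R) (t : R) : R :=
  x0 t * cos (theta0 t) + y0 t * sin (theta0 t).

Definition ytilde (x0 y0 theta0 : R -> R) (t : R) : R :=
  - x0 t * sin (theta0 t) + y0 t * cos (theta0 t).

(* The state is the column [x; y; th]. *)
Definition error_system (kw kv : R) (H : 'M[R]_N) (omega0 xt yt : R -> R)
    (t : R) (z : 'cV[R]_(N + N + N)) : 'cV[R]_(N + N + N) :=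
  let x := usubmx (usubmx z) in
  let y := dsubmx (usubmx z) in
  let th := dsubmx z in
  let dx := - kv *: (H *m x) + omega0 t *: y
            - (kw * yt t) *: (H *m th) - kw *: (cdiag y *m H *m th) in
  let dy := - omega0 t *: x
            + (kw * xt t) *: (H *m th) + kw *: (cdiag x *m H *m th) in
  let dth := - kw *: (H *m th) in
  col_mx (col_mx dx dy) dth.

End Network.

(* Main.v *)
Require Import Defs.
From HB Require Import structures.
From mathcomp Require Import all_boot all_order all_algebra.
From mathcomp Require Import all_classical all_reals all_analysis.
From mathcomp Require Import ring lra.
Set Implicit Arguments.
Unset Strict Implicit.
Unset Printing Implicit Defensive.
Import Order.TTheory GRing.Theory Num.Theory.
Import numFieldNormedType.Exports.
Local Open Scope ring_scope.

(** [H] is a nonsingular M-matrix: by a minimum principle along the spanning tree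
    [H] and its transpose have nonnegative inverses, so [H xi = 1] and
    [H^T eta = 1] have positive solutions and [P = diag (eta_i / xi_i)] satisfies
    [x^T P H x >= h x^T P x]. Hence [theta] decays exponentially, and the terms
    containing [H theta] act on the [(x, y)] subsystem as an exponentially small
    perturbation of at most quadratic growth in the Lyapunov function below.
    Since [P] is diagonal, the rotation by [omega0] preserves
    [x^T P x + y^T P y], which therefore only dissipates in [x]. Dissipation in
    [y] comes from the cross term of
    [U = lambda (x^T P x + y^T P y) - omega0^3 x^T P y]: for [lambda] large,
    [U' <= - omega0^4 U / (4 lambda) + K r e^(-gamma (t - t0)) (U + 1)], where [r]
    is the initial norm. As [omega0^4 >= 2 a omega0^2 - a^2] with [a = mu / T],
    persistent excitation turns this into exponential decay by a Gronwall
    argument. Once [theta] is known the [(x, y)] subsystem is linear with bounded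
    coefficients, so that Picard iteration in an exponentially weighted norm
    gives the solutions on the whole half line. *)

(** * One-sided derivatives and antiderivatives *)
Section OneSidedDerivative.
Context {R : realType}.
Local Open Scope classical_set_scope.
Implicit Types (a b t l : R) (f g V W : R -> R).

Lemma is_derive1E f t l :
  is_derive t 1 f l <->
  ((fun h => h^-1 * (f (t + h) - f t)) @ (0 : R)^' --> l).
Proof.
have -> : (fun h => h^-1 * (f (t + h) - f t)) =
          (fun h => h^-1 *: ((f \o shift t) (h *: 1) - f t)).
  by apply/funext => h /=; rewrite -[h%:A]/(h * 1) mulr1 [h + t]addrC.
split=> [[/cvg_ex[l' fl'] <-]|fl].
  by rewrite /derive (cvg_lim _ fl').
by split; [exact: cvgP fl|exact: cvg_lim fl].
Qed.

Lemma is_derive_fromW a f t l : is_derive t 1 f l -> is_derive_from a f t l.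
Proof. by move=> /is_derive1E; exact: cvg_within_filter. Qed.

(** Continuing [f] by its tangent line on the left of [a] makes the derivative at [a] two-sided, so
    that ordinary calculus applies up to the initial time. *)
Lemma is_derive_extension a f (df : R -> R) :
  (forall t, a <= t -> is_derive_from a f t (df t)) ->
  exists g, (forall t, a <= t -> g t = f t) /\
            (forall t, a <= t -> is_derive t 1 g (df t)).
Proof.
move=> fdf.
pose g t := if a <= t then f t else f a + df a * (t - a).
have gE t : a <= t -> g t = f t by rewrite /g => ->.
exists g; split=> [//|t at0]; apply/is_derive1E.
have /cvgrPdist_lt ft := fdf t at0.
apply/cvgrPdist_lt => e e0; have := ft e e0; rewrite near_withinE => fte.
have gl : \forall h \near (0 : R)^',
    a <= t + h \/ h^-1 * (g (t + h) - g t) = df t.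
  move: at0; rewrite le_eqVlt => /predU1P[<-|at0].
    near=> h; have [|lt_ah] := leP a (a + h); [by left|right].
    have h0 : h != 0 by near: h; exact: nbhs_dnbhs_neq.
    rewrite (gE a)// /g leNgt lt_ah /=.
    by rewrite (addrC (f a)) addrK (addrC a) addrK mulrCA mulVf ?mulr1.
  near=> h; left; rewrite -lerBlDl.
  by near: h; apply: nbhs_dnbhs; apply: lt_le_nbhsr; rewrite subr_lt0.
near=> h.
have [ath|->] : a <= t + h \/ h^-1 * (g (t + h) - g t) = df t by near: h.
  rewrite !gE//; move: ath; near: h; exact: fte.
by rewrite subrr normr0.
Unshelve. all: by end_near. Qed.

(** Mean value theorem for [W - V]. Integral inequalities below are proved in this differential
    form. *)
Lemma le_of_derive_le a V W (dV dW : R -> R) :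
  (forall t, a <= t -> is_derive t 1 V (dV t)) ->
  (forall t, a <= t -> is_derive t 1 W (dW t)) ->
  (forall t, a <= t -> dV t <= dW t) ->
  V a <= W a -> forall t, a <= t -> V t <= W t.
Proof.
move=> HV HW le Va t; rewrite le_eqVlt => /predU1P[<-//|at0].
have HD s : a <= s -> is_derive s 1 (fun x => W x - V x) (dW s - dV s).
  by move=> as0; have := HV s as0; have := HW s as0 => *; apply: is_deriveB.
have [s||s] := @MVT R (fun x => W x - V x) (fun s => dW s - dV s) a t at0.
- by rewrite in_itv/= => /andP[/ltW /HD].
- apply: derivable_within_continuous => s; rewrite in_itv/= => /andP[as0 _].
  by have [] := HD s as0.
rewrite in_itv/= => /andP[/ltW/le les _] E.
have : 0 <= (dW s - dV s) * (t - a).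
  by rewrite mulr_ge0 ?subr_ge0// ltW.
by rewrite -E; lra.
Qed.

Lemma is_derive1_continuous f t l :
  is_derive t 1 f l -> {for t, continuous f}.
Proof. by case=> ft _; apply: differentiable_continuous; exact/derivable1_diffP. Qed.

End OneSidedDerivative.

Section Antiderivative.
Context {R : realType}.
Local Open Scope classical_set_scope.
Implicit Types (a b t l : R) (f g V W : R -> R).

(* The integral starts at [a - 1] so that [antideriv a f] has a two-sided
   derivative at [a]. *)
Definition antideriv a f (t : R) : R :=
  parameterized_integral lebesgue_measure (a - 1) t f -
  parameterized_integral lebesgue_measure (a - 1) a f.

Lemma antideriv0 a f : antideriv a f a = 0.
Proof. exact: subrr. Qed.

Lemma is_derive_antideriv a f t : continuous f -> a <= t ->
  is_derive t 1 (antideriv a f) (f t).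
Proof.
move=> cf at0.
have intf : (@lebesgue_measure R).-integrable `[a - 1, t + 1] (EFin \o f).
  apply: continuous_compact_integrable; first exact: segment_compact.
  exact: continuous_subspaceT.
have tt1 : t < t + 1 by lra.
have a1t : a - 1 < t by lra.
have [df dfE] := continuous_FTC1_closed tt1 intf a1t (cf t).
rewrite -[X in is_derive _ _ _ X]subr0; apply: is_deriveB.
by split; [exact: df|rewrite -derive1E; exact: dfE].
Qed.

(** Serves to rewrite the integral in the excitation hypothesis as an increment of a primitive. *)
Lemma integral_derive a b (F f : R -> R) : a < b ->
  (forall t, a <= t -> is_derive t 1 F (f t)) ->
  (forall t, a <= t -> {for t, continuous f}) ->
  (\int[lebesgue_measure]_(t in `[a, b]) (f t)%:E = (F b - F a)%:E)%E.
Proof.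
move=> ab dF cf.
have cF t : a <= t -> {for t, continuous F}.
  by move=> /dF /is_derive1_continuous.
rewrite (@continuous_FTC2 R f F)//.
- apply: continuous_in_subspaceT => t; rewrite inE/= in_itv/= => /andP[at0 _].
  exact: cf.
- split=> [t||].
  + by rewrite in_itv/= => /andP[/ltW /dF[]].
  + by apply: cvg_at_right_filter; exact: cF.
  + by apply: cvg_at_left_filter; apply: cF; exact: ltW.
- move=> t; rewrite in_itv/= => /andP[/ltW /dF df _].
  by rewrite derive1E; exact: derive_val.
Qed.

(** Freezing the argument below [a] gives the global continuity that [is_derive_antideriv] requires
    of an integrand. *)
Lemma continuous_maxl a f : (forall t, a <= t -> {for t, continuous f}) ->
  continuous (fun t => f (Num.max a t)).
Proof.
move=> cf t; apply: (@continuous_comp _ _ _ (Num.max a) f).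
  by apply: continuous_max; [exact: cvg_cst|exact: cvg_id].
by apply: cf; rewrite le_max lexx.
Qed.

End Antiderivative.

(** * Global solutions of Lipschitz systems *)
Section Geometric.
Context {R : realType}.

Lemma geometric_lt (D e : R) : 0 < e -> exists n : nat, D / 2 ^+ n < e.
Proof.
move=> e0; exists (Num.truncn `|D / e|).+1.
pose n := (Num.truncn `|D / e|).+1; rewrite -/n ltr_pdivrMr ?exprn_gt0//.
have De : `|D / e| < n%:R by exact: Num.Theory.truncnS_gt.
have n2 : n%:R <= 2 ^+ n :> R by rewrite -natrX ler_nat ltnW// ltn_expl.
rewrite mulrC -ltr_pdivrMr//.
exact: le_lt_trans (ler_norm _) (lt_le_trans De n2).
Qed.

Lemma geometric_limit (a : nat -> R) (D : R) :
  (forall n, `|a n.+1 - a n| <= D / 2 ^+ n) ->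
  exists l, forall n, `|l - a n| <= 2 * D / 2 ^+ n.
Proof.
move=> aD.
have D0 n : 0 <= D / 2 ^+ n by exact: le_trans (aD n).
have half n : D / 2 ^+ n.+1 = D / 2 ^+ n / 2.
  by rewrite exprS invfM (mulrC 2^-1) mulrA.
(* The remaining increments from index [n] on add up to at most [2 * D / 2 ^+ n]. Subtracting this
   tail makes [b] nondecreasing, adding it makes [c] nonincreasing, and [sup b] is squeezed between
   them. *)
pose b n := a n - 2 * D / 2 ^+ n; pose c n := a n + 2 * D / 2 ^+ n.
have bS n : b n <= b n.+1.
  rewrite /b -!mulrA half; have := aD n; rewrite ler_norml => /andP[]; lra.
have cS n : c n.+1 <= c n.
  rewrite /c -!mulrA half; have := aD n; rewrite ler_norml => /andP[]; lra.
have bc n m : b n <= c m.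
  have bc k : b k <= c k by rewrite /b /c -mulrA; have := D0 k; lra.
  have bm i k : b i <= b (i + k)%N.
    by elim: k => [|k IH]; rewrite ?addn0// addnS (le_trans IH).
  have cm i k : c (i + k)%N <= c i.
    by elim: k => [|k IH]; rewrite ?addn0// addnS (le_trans _ IH).
  by rewrite (le_trans (bm n m))// (le_trans (bc _))// addnC cm.
exists (sup (range b)) => n; rewrite ler_norml.
have ub : has_ubound (range b) by exists (c 0%N) => _ [m _ <-].
have bl : b n <= sup (range b) by apply: ub_le_sup => //; exists n.
have lc : sup (range b) <= c n.
  by apply: ge_sup => [|_ [m _ <-]//]; exists (b 0%N), 0%N.
by move: bl lc; rewrite /b /c; lra.
Qed.

End Geometric.

Section Picard.
Context {R : realType} {I : finType}.
Variables (F : R -> (I -> R) -> I -> R) (t0 : R) (u0 : I -> R) (L C : R).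
Hypotheses (L0 : 0 < L) (C0 : 0 <= C).
Hypothesis F_lip : forall (t : R) (u v : I -> R) (D : R),
  (forall i, `|u i - v i| <= D) ->
  forall i, `|F t u i - F t v i| <= L * D.
Hypothesis F_cont : forall w : I -> R -> R, (forall i, continuous (w i)) ->
  forall i, continuous (fun t : R => F t (w ^~ t) i).
Hypothesis F_bnd : forall (t : R) i, `|F t u0 i| <= C.

Local Open Scope classical_set_scope.

(* With the weight [E], each Picard step halves the weighted distance,
   uniformly on the whole half line. *)
Let E (t : R) : R := expR (2 * L * (t - t0)).

Let dE (t : R) : is_derive t 1 E (2 * L * E t).
Proof.
rewrite /E; apply: is_derive_eq.
by rewrite /GRing.scale/=; ring.
Qed.

Let E_ge1 (t : R) : t0 <= t -> 1 <= E t.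
Proof.
by move=> tt0; rewrite -expR0 ler_expR mulr_ge0 ?subr_ge0// mulr_ge0 ?ltW.
Qed.

Let E_le (s t : R) : s <= t -> E s <= E t.
Proof. by move=> st; rewrite ler_expR ler_pM2l ?mulr_gt0// lerD2r. Qed.

(** The function [K * E] has derivative [2 * L * K * E], so comparing derivatives suffices. A Picard
    step with Lipschitz constant [L] uses only half of this allowance, which is the source of the
    contraction factor 1/2. *)
Lemma antideriv_dist (f g : R -> R) (K : R) :
  continuous f -> continuous g -> 0 <= K ->
  (forall t, t0 <= t -> `|f t - g t| <= 2 * L * K * E t) ->
  forall t, t0 <= t -> `|antideriv t0 f t - antideriv t0 g t| <= K * E t.
Proof.
move=> cf cg K0 fg t tt0.
have dA h s : continuous h -> t0 <= s ->
    is_derive s 1 (antideriv t0 h) (h s) := fun ch => is_derive_antideriv ch.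
have dK (s : R) : is_derive s 1 (fun t : R => K * E t) (K * (2 * L * E s)).
  by have ? := dE s; apply: is_deriveZ.
rewrite ler_distlC; apply/andP; split.
- apply: (le_of_derive_le (a := t0) (V := fun t : R => antideriv t0 f t - K * E t)
    (dV := fun s => f s - K * (2 * L * E s)) (W := antideriv t0 g) (dW := g)) => //.
  + by move=> s s0; apply: is_deriveB; exact: dA.
  + by move=> s s0; exact: dA.
  + by move=> s s0; have := fg s s0; rewrite ler_distl; lra.
  + by rewrite !antideriv0; have := mulr_ge0 K0 (expR_ge0 (2 * L * (t0 - t0)));
    rewrite /E; lra.
- apply: (le_of_derive_le (a := t0) (W := fun t : R => antideriv t0 f t + K * E t)
    (dW := fun s => f s + K * (2 * L * E s)) (V := antideriv t0 g) (dV := g)) => //.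
  + by move=> s s0; exact: dA.
  + by move=> s s0; apply: is_deriveD; exact: dA.
  + by move=> s s0; have := fg s s0; rewrite ler_distl; lra.
  + by rewrite !antideriv0; have := mulr_ge0 K0 (expR_ge0 (2 * L * (t0 - t0)));
    rewrite /E; lra.
Qed.

(** The Picard operator. Freezing the time before [t0] keeps every iterate continuous on the whole
    line, as [F_cont] demands. *)
Let P (w : I -> R -> R) (i : I) (t : R) : R :=
  u0 i + antideriv t0 (fun s => F s (w ^~ s) i) (Num.max t0 t).

Let iterP n : I -> R -> R := iter n P (fun i _ => u0 i).

Let cP (w : I -> R -> R) i : (forall j, continuous (w j)) -> continuous (P w i).
Proof.
move=> cw t; apply: cvgD; first exact: cvg_cst.
apply: (continuous_maxl (a := t0) (f := antideriv t0 _)) => s ts.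
by apply: is_derive1_continuous; apply: is_derive_antideriv => //; exact: F_cont.
Qed.

Let citerP n i : continuous (iterP n i).
Proof. by elim: n i => [|n IH] i; [move=> t; exact: cvg_cst|exact: cP]. Qed.

Let P_max w i t : P w i (Num.max t0 t) = P w i t.
Proof. by rewrite /P maxA maxxx. Qed.

Let iterP_max n i t : iterP n i (Num.max t0 t) = iterP n i t.
Proof. by case: n => //= n; rewrite P_max. Qed.

Let P_dist (v w : I -> R -> R) (K : R) :
  (forall i, continuous (v i)) -> (forall i, continuous (w i)) ->
  0 <= K -> (forall i t, t0 <= t -> `|v i t - w i t| <= K * E t) ->
  forall i t, t0 <= t -> `|P v i t - P w i t| <= K / 2 * E t.
Proof.
move=> cv cw K0 vw i t tt0; rewrite /P opprD addrACA subrr add0r.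
apply: le_trans (_ : _ <= K / 2 * E (Num.max t0 t)) _; last by rewrite (max_idPr tt0).
apply: antideriv_dist; rewrite ?le_max ?lexx ?divr_ge0//; try exact: F_cont.
move=> s s0; have := @F_lip s (v ^~ s) (w ^~ s) (K * E s) (fun j => vw j s s0) i.
by move=> /le_trans; apply; rewrite le_eqVlt; apply/orP; left; apply/eqP; field.
Qed.

(** Weighted size of the first Picard increment: its derivative is at most [C = 2 * L * D], and [E]
    is at least 1 after [t0]. *)
Let D := C / (2 * L).

Let iterP_dist n i t : t0 <= t ->
  `|iterP n.+1 i t - iterP n i t| <= D / 2 ^+ n * E t.
Proof.
have D0 : 0 <= D by rewrite divr_ge0// mulr_ge0// ltW.
elim: n i t => [|n IH] i t tt0.
  rewrite expr0 divr1 /= /P (addrC (u0 i)) addrK.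
  rewrite (max_idPr tt0).
  have A0 : antideriv t0 (fun=> 0) t = 0 :> R.
    by rewrite /antideriv /parameterized_integral /Rintegral !integral0 subrr.
  suff: `|antideriv t0 (fun s => F s u0 i) t - antideriv t0 (fun=> 0) t| <= D * E t.
    by rewrite A0 subr0.
  apply: antideriv_dist => //.
  - by apply: (F_cont (w := fun j _ => u0 j)) => j; exact: cst_continuous.
  - exact: cst_continuous.
  move=> s s0; rewrite subr0 (le_trans (F_bnd s i))//.
  have -> : 2 * L * D = C by rewrite /D; field; rewrite gt_eqF.
  by rewrite ler_peMr// E_ge1.
have K0 : 0 <= D / 2 ^+ n by apply: divr_ge0 => //; exact: exprn_ge0.
rewrite exprSr invfM mulrA.
exact: (P_dist (@citerP n.+1) (@citerP n) K0 IH).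
Qed.

Lemma picard_global : exists u : I -> R -> R,
  forall i, u i t0 = u0 i /\
    forall t, t0 <= t -> is_derive t 1 (u i) (F t (u ^~ t) i).
Proof.
have D0 : 0 <= D by rewrite divr_ge0// mulr_ge0// ltW.
have /choice[v' v'P] : forall p : I * R, exists l, forall n,
    `|l - iterP n p.1 p.2| <= 2 * (D * E (Num.max t0 p.2)) / 2 ^+ n.
  move=> [i t] /=; apply: geometric_limit => n.
  rewrite -[iterP n i t]iterP_max -[iterP n.+1 i t]iterP_max mulrAC.
  by apply: iterP_dist; rewrite le_max lexx.
pose v i t := v' (i, t).
have vP i t n : `|v i t - iterP n i t| <= 2 * D / 2 ^+ n * E (Num.max t0 t).
  by apply: le_trans (v'P (i, t) n) _; rewrite /= mulrA mulrAC.
(* Since [E] is monotone, the error bound is uniform on the half line up to [t + 1], and a uniform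
   limit of continuous iterates is continuous. *)
have cv i : continuous (v i).
  move=> t; apply/cvgrPdist_lt => e e0.
  have e3 : 0 < e / 3 by rewrite divr_gt0.
  have [n Dn] := @geometric_lt _ (2 * D * E (Num.max t0 (t + 1))) (e / 3) e3.
  have vn s : s <= t + 1 -> `|v i s - iterP n i s| < e / 3.
    move=> st; apply: le_lt_trans (vP i s n) (le_lt_trans _ Dn).
    rewrite mulrAC ler_pM2r ?invr_gt0 ?exprn_gt0//.
    apply: ler_wpM2l; first exact: mulr_ge0.
    apply: E_le.
    by rewrite ge_max le_max lexx/= le_max st orbT.
  have /cvgrPdist_lt/(_ (e / 3) e3) nb := @citerP n i t.
  near=> s.
  have s1 : s <= t + 1 by near: s; apply: lt_le_nbhsl; lra.
  have H1 := vn s s1; have t1 : t <= t + 1 by lra.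
  have H2 := vn t t1.
  have H3 : `|iterP n i t - iterP n i s| < e / 3 by near: s; exact: nb.
  move: H1 H2 H3; rewrite !ltr_norml => /andP[? ?] /andP[? ?] /andP[? ?].
  by apply/andP; split; lra.
(* Both sides are close to the iterate of index [n.+1]: [P v] by contraction, [v] by the limit
   bound. *)
have vfix i t : t0 <= t -> P v i t = v i t.
  move=> tt0; apply/eqP; rewrite -subr_eq0 -normr_le0.
  apply/ler_addgt0Pr => e e0; rewrite add0r.
  have [n Dn] := geometric_lt (2 * D * E t) e0.
  have H1 : `|P v i t - P (iterP n) i t| <= 2 * D / 2 ^+ n / 2 * E t.
    apply: (P_dist cv (@citerP n)) => //.
      by rewrite divr_ge0 ?exprn_ge0// mulr_ge0.
    by move=> j s ts; have := vP j s n; rewrite (max_idPr ts).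
  have H2 := vP i t n.+1; rewrite (max_idPr tt0) exprSr invfM mulrA in H2.
  rewrite -[P (iterP n) i t]/(iterP n.+1 i t) in H1.
  apply: le_trans (ltW Dn).
  have -> : P v i t - v i t =
            (P v i t - iterP n.+1 i t) - (v i t - iterP n.+1 i t) by ring.
  apply: le_trans (ler_normB _ _) _.
  have -> : 2 * D * E t / 2 ^+ n = 2 * D / 2 ^+ n / 2 * E t + 2 * D / 2 ^+ n / 2 * E t.
    by rewrite [2 * D * E t / _]mulrAC; field.
  exact: lerD.
(* This agrees with [v] from [t0] on. Dropping the [Num.max] of [P] makes it differentiable from
   both sides at [t0]. *)
exists (fun i t => u0 i + antideriv t0 (fun s => F s (v ^~ s) i) t) => i.
split; first by rewrite antideriv0 addr0.
move=> t tt0.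
have vE : v ^~ t = fun j => u0 j + antideriv t0 (fun s => F s (v ^~ s) j) t.
  by apply/funext => j; rewrite -vfix// /P (max_idPr tt0).
rewrite -[X in is_derive _ _ _ X]add0r -vE.
by apply: is_deriveD; apply: is_derive_antideriv => //; exact: F_cont.
Unshelve. all: by end_near. Qed.

End Picard.

(** * The M-matrix of the network *)
Section FiniteSums.
Context {R : realType}.

(** The reciprocal of one plus the sum of the reciprocals works, also for an empty [I], where no
    minimum exists. *)
Lemma pos_lower_bound (I : finType) (f : I -> R) :
  (forall i, 0 < f i) -> exists2 m, 0 < m & forall i, m <= f i.
Proof.
move=> f0; have S0 : 0 <= \sum_i (f i)^-1 by apply: sumr_ge0 => i _; rewrite invr_ge0 ltW.
exists (1 + \sum_i (f i)^-1)^-1 => [|i]; first by rewrite invr_gt0; lra.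
rewrite -[leRHS]invrK lef_pV2 ?posrE ?invr_gt0//; last by lra.
rewrite (bigD1 i)//=.
have : 0 <= \sum_(j | j != i) (f j)^-1 by apply: sumr_ge0 => j _; rewrite invr_ge0 ltW.
by lra.
Qed.

Lemma pos_upper_bound (I : finType) (f : I -> R) :
  exists2 m, 0 < m & forall i, f i <= m.
Proof.
have S0 : 0 <= \sum_i `|f i| by exact: sumr_ge0.
exists (1 + \sum_i `|f i|) => [|i]; first by lra.
rewrite (le_trans (ler_norm _))// (bigD1 i)//=.
have : 0 <= \sum_(j | j != i) `|f j| by exact: sumr_ge0.
by lra.
Qed.

Lemma sqr_sum_le (I : finType) (f : I -> R) :
  (\sum_i f i) ^+ 2 <= #|I|%:R * \sum_i f i ^+ 2.
Proof.
rewrite expr2 mulr_suml; under eq_bigr do rewrite mulr_sumr.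
apply: le_trans (_ : \sum_i \sum_j (f i ^+ 2 + f j ^+ 2) / 2 <= _).
  apply: ler_sum => i _; apply: ler_sum => j _.
  by have := sqr_ge0 (f i - f j); lra.
under eq_bigr do rewrite -mulr_suml big_split/= sumr_const.
rewrite -mulr_suml big_split/= sumr_const.
by rewrite -mulr_natl -sumrMnl; under eq_bigr do rewrite -mulr_natl; rewrite -mulr_sumr; lra.
Qed.

End FiniteSums.

Section MMatrix.
Context {R : realType} {N : nat}.
Variables (e : rel 'I_N.+1) (a : 'M[R]_(N, N.+1)).
Hypotheses (ha : adapted_weights e a)
  (htree : has_spanning_tree_rooted_at e ord0).

Let a_ge0 i j : 0 <= a i j. Proof. by case: (ha i j). Qed.

(** [H] is the graph Laplacian grounded at the leader: after extending [v] by 0 there, each row is a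
    weighted sum of differences along incoming edges. *)
Lemma Hmx_mulE (v : 'cV[R]_N) (V : 'I_N.+1 -> R) i :
  V ord0 = 0 -> (forall j, V (follower j) = v j 0) ->
  (Hmx a *m v) i 0 = \sum_k a i k * (V (follower i) - V k).
Proof.
move=> V0 Vf; rewrite mxE.
have af : a i (follower i) = 0 by have [_ ->] := ha i (follower i).
under [RHS]eq_bigr do rewrite mulrBr.
rewrite sumrB -mulr_suml [X in _ = _ - X]big_ord_recl V0 mulr0 add0r.
rewrite (bigD1 i)//= mxE eqxx Vf.
rewrite [in RHS](bigD1 i)//= -/(follower i) af mul0r add0r.
congr (_ + _); rewrite -sumrN; apply: eq_bigr => j ji.
by rewrite mxE eq_sym (negPf ji) mulNr -/(follower j) Vf.
Qed.

(* Discrete minimum principle. *)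
Lemma Hmx_nonneg (v : 'cV[R]_N) :
  (forall i, 0 <= (Hmx a *m v) i 0) -> forall i, 0 <= v i 0.
Proof.
move=> Hv.
pose V (k : 'I_N.+1) : R := if unlift ord0 k is Some j then v j 0 else 0.
have V0 : V ord0 = 0 by rewrite /V unlift_none.
have Vf j : V (follower j) = v j 0 by rewrite /V liftK.
have [m _ mP] : exists2 k0 : 'I_N.+1, true & forall k, V k0 <= V k.
  by have [k0 _ k0P] := arg_minP V (isT : xpredT (@ord0 N)); exists k0 => // k; exact: k0P.
suff Vm0 : V m = 0 by move=> i; rewrite -Vf -Vm0.
apply/eqP; apply: contraT => Vm.
(* Contrapositive: at a follower attaining the minimum all summands of the row are nonpositive while
   their sum is nonnegative, so every in-neighbour attains it too. The leader does not attain it,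
   because [V m] is nonzero. *)
have step u w : e u w -> V u != V m -> V w != V m.
  move=> euw; apply: contra => /eqP Vw.
  case: (unliftP ord0 w) => [i wE|wE]; last first.
    by move: Vm; rewrite -Vw wE V0 eqxx.
  rewrite -/(follower i) in wE.
  have := Hv i; rewrite (@Hmx_mulE v V)//.
  have [_ _ aiu] := ha i u.
  have [uf|/eqP uf] := eqVneq u (follower i); first by rewrite uf -wE Vw.
  have aiu0 : 0 < a i u by apply/aiu => //; rewrite -wE.
  rewrite -wE Vw => S0.
  have le0 k : a i k * (V m - V k) <= 0 by rewrite mulr_ge0_le0// subr_le0.
  have Su : \sum_(k | k != u) a i k * (V m - V k) <= 0 by exact: sumr_le0.
  move: S0; rewrite (bigD1 u)//= => S0.
  have := le0 u; have /andP[] : 0 <= a i u * (V m - V u) <= 0.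
    by rewrite le0 andbT; lra.
  rewrite pmulr_rge0// subr_ge0 => Vum _ _.
  by rewrite eq_le Vum mP.
(* Propagating non-minimality from the leader along the tree path to [m] gives the contradiction. *)
have [t [te _ _ tc]] := htree.
have := tc m => /connectP[p pt pm].
suff : forall u q, path t u q -> V u != V m -> V (last u q) != V m.
  by move=> /(_ _ _ pt); rewrite -pm eqxx V0 eq_sym => /(_ Vm).
move=> u q; elim: q u => [//|w q IH] u /= /andP[tuw pq] Vu.
by apply: IH pq (step u w (te _ _ tuw) Vu).
Qed.

Lemma Hmx_offdiag i j : i != j -> Hmx a i j <= 0.
Proof. by move=> ij; rewrite mxE (negPf ij) oppr_le0. Qed.

(** The minimum principle, applied to a kernel vector and to its opposite, forces it to vanish. *)
Lemma Hmx_unit : Hmx a \in unitmx.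
Proof.
rewrite -unitmx_tr -row_free_unit; apply: inj_row_free => u uH.
have Hu : Hmx a *m u^T = 0 by rewrite -[Hmx a]trmxK -trmx_mul uH trmx0.
have u0 i : 0 <= u 0 i.
  by have := @Hmx_nonneg u^T _ i; rewrite mxE; apply => j; rewrite Hu mxE.
have u1 i : 0 <= - u 0 i.
  have := @Hmx_nonneg (- u^T) _ i; rewrite !mxE; apply => j.
  by rewrite mulmxN Hu oppr0 mxE.
by apply/matrixP => i j; rewrite ord1 mxE; apply/eqP; rewrite eq_le u0 andbT -oppr_ge0.
Qed.

(** [H] maps the columns of its inverse to basis vectors, so the minimum principle applies to
    them. *)
Lemma Hmx_inv_ge0 i j : 0 <= invmx (Hmx a) i j.
Proof.
have := @Hmx_nonneg (col j (invmx (Hmx a))) _ i; rewrite mxE; apply => k.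
by rewrite colE mulmxA mulmxV ?Hmx_unit// mul1mx mxE ler0n.
Qed.

(** At a zero entry of [v] the diagonal term vanishes and the remaining ones are nonpositive, which
    contradicts the positive row value. *)
Lemma pos_of_mul_offdiag (M : 'M[R]_N) (v : 'cV[R]_N) :
  (forall i j, i != j -> M i j <= 0) -> (forall i, 0 <= v i 0) ->
  (forall i, 0 < (M *m v) i 0) -> forall i, 0 < v i 0.
Proof.
move=> M0 v0 Mv i; rewrite lt_def v0 andbT; apply/eqP => vi.
have := Mv i; rewrite mxE (bigD1 i)//= vi mulr0 add0r ltNge => /negP; apply.
by apply: sumr_le0 => j ji; rewrite mulr_le0_ge0// M0 // eq_sym.
Qed.

Lemma exists_pos_right : exists2 xi : 'cV[R]_N,
  forall i, 0 < xi i 0 & forall i, (Hmx a *m xi) i 0 = 1.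
Proof.
pose xi : 'cV[R]_N := invmx (Hmx a) *m const_mx 1.
have Hxi i : (Hmx a *m xi) i 0 = 1 by rewrite mulKVmx ?Hmx_unit// mxE.
exists xi => //; apply: (pos_of_mul_offdiag Hmx_offdiag) => i; last by rewrite Hxi.
by rewrite mxE; apply: sumr_ge0 => j _; rewrite mulr_ge0 ?Hmx_inv_ge0// mxE.
Qed.

(** The matrix [H^T] need not come from a network, so the minimum principle is not applied to it.
    Its inverse is nonnegative as the transpose of the inverse of [H]. *)
Lemma exists_pos_left : exists2 eta : 'cV[R]_N,
  forall i, 0 < eta i 0 & forall i, ((Hmx a)^T *m eta) i 0 = 1.
Proof.
have Htr_unit : (Hmx a)^T \in unitmx by rewrite unitmx_tr Hmx_unit.
pose eta : 'cV[R]_N := invmx (Hmx a)^T *m const_mx 1.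
have Heta i : ((Hmx a)^T *m eta) i 0 = 1 by rewrite mulKVmx// mxE.
exists eta => //; apply: (pos_of_mul_offdiag (M := (Hmx a)^T)) => [i j ij|i|i].
- by rewrite mxE Hmx_offdiag// eq_sym.
- rewrite mxE; apply: sumr_ge0 => j _.
  by rewrite mulr_ge0// -?trmx_inv ?[(invmx _)^T _ _]mxE ?Hmx_inv_ge0// mxE.
- by rewrite Heta.
Qed.

Lemma Hmx_diagonal_lyapunov : exists (p : 'I_N -> R) (h : R),
  [/\ forall i, 0 < p i, 0 < h &
    forall x : 'cV[R]_N,
      h * \sum_i p i * (x i 0 * x i 0) <= \sum_i p i * (x i 0 * (Hmx a *m x) i 0)].
Proof.
have [xi xi0 Hxi] := exists_pos_right; have [eta eta0 Heta] := exists_pos_left.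
(* In the variables [w_i = x_i / xi_i] the form dominates the sum of
   [(eta_i + xi_i) / 2 * w_i ^+ 2], while [x^T P x] is the sum of [eta_i * xi_i * w_i ^+ 2]. The
   constant [h] bounds the ratios of these coefficients from below. *)
have ratio0 i : 0 < (eta i 0 + xi i 0) / (2 * (eta i 0 * xi i 0)).
  by rewrite divr_gt0 ?addr_gt0 ?mulr_gt0.
have [h h0 hP] := pos_lower_bound ratio0.
exists (fun i => eta i 0 / xi i 0), h; split=> // [i|x]; first exact: divr_gt0.
have xine i : xi i 0 != 0 by rewrite gt_eqF.
pose w i := x i 0 / xi i 0.
have xE i : x i 0 = xi i 0 * w i by rewrite /w mulrC divfK.
(* [diag eta * H * diag xi] has nonpositive off-diagonal entries and positive row
   and column sums, and [m_ij w_i w_j >= m_ij (w_i^2 + w_j^2) / 2] entrywise. *)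
pose m i j := eta i 0 * Hmx a i j * xi j 0.
have -> : \sum_i eta i 0 / xi i 0 * (x i 0 * (Hmx a *m x) i 0) =
          \sum_i \sum_j m i j * (w i * w j).
  apply: eq_bigr => i _; rewrite mxE !mulr_sumr; apply: eq_bigr => j _.
  by rewrite (xE i) (xE j) /m; field.
have row_m i : \sum_j m i j = eta i 0.
  have := Hxi i; rewrite mxE => E; under eq_bigr do rewrite /m -mulrA.
  by rewrite -mulr_sumr E mulr1.
have col_m j : \sum_i m i j = xi j 0.
  have := Heta j; rewrite mxE => E.
  rewrite /m -mulr_suml -[RHS]mul1r -E; congr (_ * _).
  by apply: eq_bigr => i _; rewrite mulrC [X in _ = X * _]mxE.
apply: le_trans (_ : \sum_i \sum_j m i j * ((w i ^+ 2 + w j ^+ 2) / 2) <= _); last first.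
  apply: ler_sum => i _; apply: ler_sum => j _.
  have [->|ij] := eqVneq i j; first by rewrite le_eqVlt; apply/orP; left; apply/eqP; field.
  have m0 : m i j <= 0.
    by rewrite /m mulr_le0_ge0 ?(ltW (xi0 _))// mulr_ge0_le0 ?(ltW (eta0 _)) ?Hmx_offdiag.
  rewrite ler_wnM2l//.
  by have := sqr_ge0 (w i - w j); lra.
have -> : \sum_i \sum_j m i j * ((w i ^+ 2 + w j ^+ 2) / 2) =
          \sum_i (eta i 0 + xi i 0) / 2 * w i ^+ 2.
  have mE i j : m i j * ((w i ^+ 2 + w j ^+ 2) / 2) =
                m i j * (w i ^+ 2 / 2) + m i j * (w j ^+ 2 / 2) by field.
  under eq_bigr => i _ do under eq_bigr => j _ do rewrite mE.
  under eq_bigr => i _ do rewrite big_split/= -mulr_suml row_m.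
  rewrite big_split/= exchange_big/=.
  under [X in _ + X]eq_bigr => i _ do rewrite -mulr_suml col_m.
  by rewrite -big_split; apply: eq_bigr => i _ /=; field.
rewrite mulr_sumr; apply: ler_sum => i _.
have := hP i; rewrite ler_pdivlMr ?mulr_gt0// => hi.
rewrite xE.
have -> : h * (eta i 0 / xi i 0 * (xi i 0 * w i * (xi i 0 * w i))) =
  h * (2 * (eta i 0 * xi i 0)) / 2 * w i ^+ 2 by field.
by rewrite ler_wpM2r ?sqr_ge0// ler_pM2r.
Qed.

End MMatrix.

(** * Lyapunov estimates *)
Section Scalar.
Context {R : realType}.

Lemma expr_norm_le (w W : R) n : `|w| <= W -> `|w ^+ n| <= W ^+ n.
Proof. by move=> wW; rewrite normrX lerXn2r// nnegrE (le_trans _ wW). Qed.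

Lemma sqr_le_norm (q z : R) : 0 <= z -> q ^+ 2 <= z ^+ 2 -> `|q| <= z.
Proof. by move=> z0; rewrite -[q ^+ 2]real_normK ?num_real// ler_pXn2r ?nnegrE. Qed.

(** Keeps the cross term of [U] small against its leading part, so that [U] is comparable to the
    weighted square norm of [(x, y)]. *)
Lemma coupling_bound (w W x y : R) : `|w| <= W ->
  `|w ^+ 3 * (x * y)| <= W ^+ 3 / 2 * (x ^+ 2 + y ^+ 2).
Proof.
move=> wW; rewrite normrM -mulrA; apply: ler_pM => //; first exact: expr_norm_le.
by rewrite ler_norml; have := sqr_ge0 (x - y); have := sqr_ge0 (x + y); lra.
Qed.

(* Young's inequality on the two products in which [w ^+ 2 * y] appears; this is
   why the cross term of the Lyapunov function carries the factor [w ^+ 3]. *)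
Lemma lyapunov_derivative_pointwise
    (lam kv w dw W M2 xt yt rho x y hx q dx dy : R) :
  0 <= lam -> `|w| <= W -> `|dw| <= W -> `|xt| <= M2 -> `|yt| <= M2 ->
  `|q| <= rho ->
  dx = - kv * hx + w * y - (yt + y) * q ->
  dy = - w * x + (xt + x) * q ->
  lam * (2 * (x * dx) + 2 * (y * dy))
    - (3 * w ^+ 2 * dw * (x * y) + w ^+ 3 * (dx * y + x * dy)) <=
  - (2 * lam * kv) * (x * hx) + (9 * W ^+ 2 + W ^+ 4) * x ^+ 2
  + kv ^+ 2 * W ^+ 2 * hx ^+ 2 - w ^+ 4 / 2 * y ^+ 2
  + rho * ((2 * lam + W ^+ 3) * M2 + W ^+ 3) * (x ^+ 2 + y ^+ 2 + 1).
Proof.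
move=> lam0 wW dwW xtM ytM qr -> ->.
have W0 : 0 <= W by exact: le_trans wW.
have M0 : 0 <= M2 by exact: le_trans xtM.
have r0 : 0 <= rho by exact: le_trans qr.
(* All that multiplies the perturbation [q]. In the part with [lam] the products [x * y] cancel, and
   the whole is at most quadratic in [(x, y)]. *)
pose Tq := 2 * lam * (y * xt - x * yt) + w ^+ 3 * ((yt + y) * y - (xt + x) * x).
have Ha : - (3 * w ^+ 2 * dw * (x * y)) <= 9 * W ^+ 2 * x ^+ 2 + w ^+ 4 / 4 * y ^+ 2.
  have dw2 : dw ^+ 2 <= W ^+ 2.
    by have := expr_norm_le 2 dwW; rewrite ger0_norm ?sqr_ge0.
  have H1 : 9 * dw ^+ 2 * x ^+ 2 <= 9 * W ^+ 2 * x ^+ 2.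
    by rewrite ler_wpM2r ?sqr_ge0// ler_wpM2l.
  have := sqr_ge0 (3 * dw * x + w ^+ 2 * y / 2).
  have -> : (3 * dw * x + w ^+ 2 * y / 2) ^+ 2 =
    9 * dw ^+ 2 * x ^+ 2 + 3 * w ^+ 2 * dw * (x * y) + w ^+ 4 / 4 * y ^+ 2 by field.
  by move: H1; set a1 := 9 * _ * _; set a2 := 9 * _ * _; set a3 := 3 * _ * _ * _; lra.
have w2 : w ^+ 2 <= W ^+ 2.
  by have := expr_norm_le 2 wW; rewrite ger0_norm ?sqr_ge0.
have Hb : kv * w ^+ 3 * hx * y <= kv ^+ 2 * W ^+ 2 * hx ^+ 2 + w ^+ 4 / 4 * y ^+ 2.
  have H1 : kv ^+ 2 * w ^+ 2 * hx ^+ 2 <= kv ^+ 2 * W ^+ 2 * hx ^+ 2.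
    by rewrite ler_wpM2r ?sqr_ge0// ler_wpM2l ?sqr_ge0.
  have := sqr_ge0 (kv * w * hx - w ^+ 2 * y / 2).
  have -> : (kv * w * hx - w ^+ 2 * y / 2) ^+ 2 =
    kv ^+ 2 * w ^+ 2 * hx ^+ 2 - kv * w ^+ 3 * hx * y + w ^+ 4 / 4 * y ^+ 2 by field.
  by move: H1; set a1 := kv ^+ 2 * _ * _; set a2 := kv ^+ 2 * _ * _;
     set a3 := kv * _ * _ * _; lra.
have Hc : w ^+ 4 * x ^+ 2 <= W ^+ 4 * x ^+ 2.
  rewrite ler_wpM2r ?sqr_ge0//.
  by have := expr_norm_le 4 wW; rewrite ger0_norm ?exprn_even_ge0.
have Hq : Tq * q <= rho * ((2 * lam + W ^+ 3) * M2 + W ^+ 3) * (x ^+ 2 + y ^+ 2 + 1).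
  rewrite (le_trans (ler_norm _))// normrM mulrC -mulrA; apply: ler_pM => //.
  have nx : `|x| <= (x ^+ 2 + 1) / 2.
    by rewrite ler_norml; have := sqr_ge0 (x - 1); have := sqr_ge0 (x + 1); lra.
  have ny : `|y| <= (y ^+ 2 + 1) / 2.
    by rewrite ler_norml; have := sqr_ge0 (y - 1); have := sqr_ge0 (y + 1); lra.
  have nxt : `|x * xt| <= (x ^+ 2 + 1) / 2 * M2 by rewrite normrM ler_pM.
  have nxy : `|x * yt| <= (x ^+ 2 + 1) / 2 * M2 by rewrite normrM ler_pM.
  have nyt : `|y * xt| <= (y ^+ 2 + 1) / 2 * M2 by rewrite normrM ler_pM.
  have nyy : `|y * yt| <= (y ^+ 2 + 1) / 2 * M2 by rewrite normrM ler_pM.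
  have A0 : 0 <= x ^+ 2 + y ^+ 2 by rewrite addr_ge0 ?sqr_ge0.
  pose B := (x ^+ 2 + y ^+ 2 + 1) * M2.
  have A1 : (x ^+ 2 + 1) / 2 * M2 + (y ^+ 2 + 1) / 2 * M2 <= B.
    by rewrite /B -mulrDl ler_wpM2r//; lra.
  have n1 : `|y * xt - x * yt| <= B.
    by rewrite (le_trans (ler_normB _ _))// (le_trans (lerD nyt nxy))// addrC.
  have n2 : `|(yt + y) * y - (xt + x) * x| <= B + (x ^+ 2 + y ^+ 2 + 1).
    have -> : (yt + y) * y - (xt + x) * x = (y * yt - x * xt) + (y ^+ 2 - x ^+ 2) by ring.
    rewrite (le_trans (ler_normD _ _))// lerD//.
      by rewrite (le_trans (ler_normB _ _))// (le_trans (lerD nyy nxt))// addrC.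
    by rewrite ler_norml; have := sqr_ge0 x; have := sqr_ge0 y; lra.
  rewrite /Tq (le_trans (ler_normD _ _))//.
  have -> : ((2 * lam + W ^+ 3) * M2 + W ^+ 3) * (x ^+ 2 + y ^+ 2 + 1) =
    2 * lam * B + W ^+ 3 * (B + (x ^+ 2 + y ^+ 2 + 1)) by rewrite /B; ring.
  rewrite lerD// normrM ler_pM//; last exact: expr_norm_le.
  by rewrite ger0_norm// mulr_ge0.
(* The rotation contributes nothing to the part with [lam]. Through the cross term it yields the
   dissipation [- w ^+ 4 * y ^+ 2] and the harmful [w ^+ 4 * x ^+ 2]. *)
have -> : lam * (2 * (x * (- kv * hx + w * y - (yt + y) * q)) +
        2 * (y * (- w * x + (xt + x) * q))) -
   (3 * w ^+ 2 * dw * (x * y) +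
    w ^+ 3 * ((- kv * hx + w * y - (yt + y) * q) * y + x * (- w * x + (xt + x) * q))) =
  - (2 * lam * kv) * (x * hx) + - (3 * w ^+ 2 * dw * (x * y)) +
  kv * w ^+ 3 * hx * y + w ^+ 4 * x ^+ 2 - w ^+ 4 * y ^+ 2 + Tq * q.
  by rewrite /Tq; ring.
have -> : (9 * W ^+ 2 + W ^+ 4) * x ^+ 2 = 9 * W ^+ 2 * x ^+ 2 + W ^+ 4 * x ^+ 2 by ring.
have -> : w ^+ 4 / 2 * y ^+ 2 =
  w ^+ 4 * y ^+ 2 - w ^+ 4 / 4 * y ^+ 2 - w ^+ 4 / 4 * y ^+ 2 by field.
by move: Ha Hb Hc Hq; clear; set a1 := - (3 * _ * _ * _); set a2 := 9 * _ * _;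
  set a3 := w ^+ 4 / 4 * _; set a4 := kv * _ * _ * _; set a5 := kv ^+ 2 * _ * _;
  set a6 := w ^+ 4 * _; set a7 := W ^+ 4 * _; set a8 := Tq * _; set a9 := rho * _ * _; lra.
Qed.

(** The integrating factor [expR (Phi + psi)], where [psi] has derivative
    [- k * expR (- gam * (t - t0))], removes the terms linear in [U]. As [Phi] grows at rate at most
    [gam / 2], the source times this factor still decays at rate [gam / 2] and has a finite total
    effect. *)
Lemma gronwall_decay (U dU Phi phi : R -> R) (t0 gam k : R) :
  0 < gam -> 0 <= k ->
  (forall t, t0 <= t -> is_derive t 1 U (dU t)) ->
  (forall t, t0 <= t -> is_derive t 1 Phi (phi t)) ->
  (forall t, t0 <= t -> 0 <= U t) ->
  Phi t0 = 0 ->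
  (forall t, t0 <= t -> Phi t <= gam / 2 * (t - t0)) ->
  (forall t, t0 <= t -> dU t <= (- phi t + k * expR (- gam * (t - t0))) * U t
                               + k * expR (- gam * (t - t0))) ->
  forall t, t0 <= t ->
    U t <= (U t0 + 2 * k / gam) * expR (k / gam) * expR (- Phi t).
Proof.
move=> gam0 k0 HU HPhi U0 Phi0 Phile dUle t tt0.
have gne : gam != 0 by rewrite gt_eqF.
pose psi s := k / gam * expR (- gam * (s - t0)).
have dpsi (s : R) : is_derive s 1 psi (- (k * expR (- gam * (s - t0)))).
  by rewrite /psi; apply: is_derive_eq; rewrite /GRing.scale/=; field.
have psi0 s : 0 <= psi s by rewrite /psi mulr_ge0 ?expR_ge0// divr_ge0// ltW.
have psik s : t0 <= s -> psi s <= k / gam.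
  move=> s0; rewrite ler_piMr ?divr_ge0// ?(ltW gam0)// -expR0 ler_expR.
  by rewrite mulNr oppr_le0 mulr_ge0 ?subr_ge0// ltW.
pose V s := U s * expR (Phi s + psi s).
(* The total integral of [k * expR (k / gam) * expR (- (gam / 2) * (s - t0))] over the half line,
   which dominates the derivative of [V]. *)
pose c := 2 * k / gam * expR (k / gam).
pose W s := V t0 + c * (1 - expR (- (gam / 2) * (s - t0))).
have c0 : 0 <= c by rewrite mulr_ge0 ?expR_ge0// divr_ge0 ?(ltW gam0)// mulr_ge0.
have VW : V t <= W t.
  apply: (@le_of_derive_le _ t0 V W
    (fun s => (dU s + U s * (phi s - k * expR (- gam * (s - t0)))) * expR (Phi s + psi s))
    (fun s => k * expR (k / gam) * expR (- (gam / 2) * (s - t0)))) => //.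
  - move=> s s0; have d1 := HU s s0; have d2 := HPhi s s0; have d3 := dpsi s.
    by rewrite /V; apply: is_derive_eq; rewrite /GRing.scale/=; ring.
  - move=> s s0; rewrite /W; apply: is_derive_eq; rewrite /GRing.scale/= /c; field.
    by [].
  - move=> s s0.
    apply: le_trans (_ : _ <= k * expR (- gam * (s - t0)) * expR (Phi s + psi s)) _.
      rewrite ler_pM2r ?expR_gt0//; have := dUle s s0.
      by set a1 := k * _; lra.
    rewrite -!mulrA ler_wpM2l// -!expRD ler_expR.
    by have := Phile s s0; have := psik s s0; lra.
  - by rewrite /W subrr mulr0 expR0 subrr mulr0 addr0.
have UV : U t = V t * expR (- (Phi t + psi t)).
  by rewrite /V -mulrA -expRD subrr expR0 mulr1.
have Wle : W t <= (U t0 + 2 * k / gam) * expR (k / gam).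
  rewrite /W mulrDl; apply: lerD.
    rewrite /V ler_wpM2l ?U0// ler_expR Phi0 add0r.
    exact: psik.
  by rewrite ler_piMr// gerBl expR_ge0.
rewrite UV; apply: ler_pM; rewrite ?expR_ge0//.
- by rewrite mulr_ge0 ?U0 ?expR_ge0.
- exact: le_trans VW Wle.
- by rewrite ler_expR opprD gerDl oppr_le0.
Qed.

(** Each full window of length [T] between [t0] and [t] contributes [mu]. The [- 1] pays for the
    incomplete last window. *)
Lemma excitation_growth (g : R -> R) (T mu t0 t : R) :
  0 < T -> 0 <= t0 -> t0 <= t ->
  (forall s u, 0 <= s -> s <= u -> g s <= g u) ->
  (forall s, 0 <= s -> mu <= g (s + T) - g s) -> 0 <= mu ->
  mu * ((t - t0) / T - 1) <= g t - g t0.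
Proof.
move=> T0 t00 tt0 gmono gT mu0.
have step n : mu *+ n <= g (t0 + T *+ n) - g t0.
  elim: n => [|n IH]; first by rewrite !mulr0n addr0 subrr.
  have s0 : 0 <= t0 + T *+ n by rewrite addr_ge0// mulrn_wge0// ltW.
  by have := gT _ s0; rewrite !mulrSr addrA; lra.
pose n := Num.truncn ((t - t0) / T).
have d0 : 0 <= (t - t0) / T by rewrite divr_ge0 ?subr_ge0// ltW.
have /andP[n1 n2] := truncn_itv d0.
have H1 : g (t0 + T *+ n) <= g t.
  apply: gmono; first by rewrite addr_ge0// mulrn_wge0// ltW.
  by move: n1; rewrite ler_pdivlMr// mulr_natl; lra.
have H2 : mu * ((t - t0) / T - 1) <= mu *+ n.
  by rewrite -mulr_natr ler_wpM2l//; move: n2; rewrite -natr1; lra.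
have := step n; lra.
Qed.

End Scalar.

(** * Uniform exponential decay of the tracking errors *)

Section Tracking.
Context {R : realType} {N : nat}.

(** Vectors are plain functions here, so that a trajectory is a family of real functions to be
    differentiated entrywise. *)
Definition mulv (H : 'M[R]_N) (x : 'I_N -> R) i := \sum_j H i j * x j.
Definition wdot (p x y : 'I_N -> R) := \sum_i p i * (x i * y i).

Lemma is_derive_bigsum (f : 'I_N -> R -> R) (df : 'I_N -> R) (t : R) :
  (forall i, is_derive t 1 (f i) (df i)) ->
  is_derive t 1 (fun s => \sum_i f i s) (\sum_i df i).
Proof.
move=> fdf; have -> : (fun s => \sum_i f i s) = \sum_i f i.
  by apply/funext => s; rewrite fct_sumE.
exact: is_derive_sum.
Qed.

Lemma is_derive_lyapunov (c lam dx dy dw : R) (x y w : R -> R) (s : R) :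
  is_derive s 1 x dx -> is_derive s 1 y dy -> is_derive s 1 w dw ->
  is_derive s 1
    (fun s => c * (lam * (x s * x s + y s * y s) - w s ^+ 3 * (x s * y s)))
    (c * (lam * (2 * (x s * dx) + 2 * (y s * dy))
      - (3 * w s ^+ 2 * dw * (x s * y s) + w s ^+ 3 * (dx * y s + x s * dy)))).
Proof.
move=> d1 d2 d3; apply: is_derive_eq; rewrite /GRing.scale/=.
move: (x s) (y s) (w s) => xs ys ws; clear.
ring.
Qed.

Variables (H : 'M[R]_N) (p : 'I_N -> R) (h : R).
Hypotheses (p0 : forall i, 0 < p i) (h0 : 0 < h).
Local Notation Hf := (mulv H).
Local Notation dot := (wdot p).
Hypothesis H_coercive : forall x, h * dot x x <= dot x (Hf x).

Let S_ge0 x : 0 <= dot x x.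
Proof. by apply: sumr_ge0 => i _; rewrite mulr_ge0 ?(ltW (p0 _))// -expr2 sqr_ge0. Qed.

(** Needed to absorb the square of [H x] left by Young's inequality, and to bound [H theta] by the
    decaying [theta]. *)
Let H_bounded : exists2 B, 0 < B & forall x, dot (Hf x) (Hf x) <= B * dot x x.
Proof.
have [B B0 HB] := pos_upper_bound (fun j => (\sum_i p i * N%:R * H i j ^+ 2) / p j).
exists B => // x; rewrite /wdot mulr_sumr.
apply: le_trans (_ : \sum_i \sum_j p i * N%:R * H i j ^+ 2 * x j ^+ 2 <= _).
  apply: ler_sum => i _; rewrite -expr2.
  have := sqr_sum_le (fun j => H i j * x j); rewrite card_ord -/(mulv H x i) => HH.
  rewrite -(ler_pM2l (p0 i)) in HH; apply: le_trans HH _.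
  rewrite mulrA mulr_sumr le_eqVlt; apply/orP; left; apply/eqP.
  by apply: eq_bigr => j _; rewrite exprMn mulrA.
rewrite exchange_big/=; apply: ler_sum => j _.
rewrite -mulr_suml -expr2 [leRHS]mulrA ler_wpM2r ?sqr_ge0//.
by rewrite -ler_pdivrMr.
Qed.

Variables (kw kv W M2 T mu : R) (w dw g xt yt : R -> R).
Hypotheses (kw0 : 0 < kw) (kv0 : 0 < kv) (W0 : 0 < W) (M20 : 0 < M2)
  (T0 : 0 < T) (mu0 : 0 < mu).
Hypotheses (w_le : forall t : R, 0 <= t -> `|w t| <= W)
  (dw_le : forall t : R, 0 <= t -> `|dw t| <= W)
  (xt_le : forall t : R, 0 <= t -> `|xt t| <= M2)
  (yt_le : forall t : R, 0 <= t -> `|yt t| <= M2)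
  (w_derive : forall t : R, 0 <= t -> is_derive t 1 w (dw t))
  (g_derive : forall t : R, 0 <= t -> is_derive t 1 g (w t ^+ 2))
  (g_growth : forall t : R, 0 <= t -> mu <= g (t + T) - g t).

Let g_mono (s u : R) : 0 <= s -> s <= u -> g s <= g u.
Proof.
move=> s0; apply: (@le_of_derive_le _ s (fun=> g s) g (fun=> 0) (fun t => w t ^+ 2)).
- by move=> t st; apply: g_derive; exact: le_trans st.
- by move=> t _; exact: sqr_ge0.
- by [].
Qed.

Lemma wdot_decay (t0 : R) (th : 'I_N -> R -> R) :
  (forall t : R, t0 <= t -> forall i, is_derive t 1 (th i) (- kw * Hf (th ^~ t) i)) ->
  forall t, t0 <= t -> dot (th ^~ t) (th ^~ t) <=
    dot (th ^~ t0) (th ^~ t0) * expR (- (2 * (kw * h) * (t - t0))).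
Proof.
move=> dth t tt0.
have kwh : 0 < kw * h by exact: mulr_gt0.
have dS s : t0 <= s -> is_derive s 1 (fun s => dot (th ^~ s) (th ^~ s))
    (- (2 * kw) * dot (th ^~ s) (Hf (th ^~ s))).
  move=> s0; rewrite /wdot mulr_sumr; apply: is_derive_bigsum => i.
  by have d := dth s s0 i; apply: is_derive_eq; rewrite /GRing.scale/=; ring.
(* There is no source, so [k = 0], and [4 * (kw * h)] is the value of [gam] with [gam / 2] equal to
   the decay rate. *)
have := @gronwall_decay R (fun s => dot (th ^~ s) (th ^~ s)) _
  (fun s => 2 * (kw * h) * (s - t0)) (fun=> 2 * (kw * h)) t0 (4 * (kw * h)) 0
  _ (lexx 0) dS _ _ _ _ _ t tt0.
rewrite !(mulr0, mul0r, addr0, expR0, mulr1); apply.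
- by rewrite mulr_gt0.
- by move=> s _; apply: is_derive_eq; rewrite /GRing.scale/=; ring.
- by [].
- by rewrite subrr mulr0.
- by move=> s _; rewrite le_eqVlt; apply/orP; left; apply/eqP; field.
- move=> s s0; rewrite ?(mul0r, addr0).
  have -> : - (2 * (kw * h)) * dot (th ^~ s) (th ^~ s) =
            - (2 * kw) * (h * dot (th ^~ s) (th ^~ s)) by ring.
  by rewrite ler_wnM2l// oppr_le0 mulr_ge0// ltW.
Qed.

(** The constants are chosen before the initial time and the radius [r], which gives uniformity. The
    estimate concerns squared norms, hence the rate [2 * C]. *)
Lemma tracking_bound : exists A B C : R, [/\ 0 < A, 0 < B, 0 < C &
  forall (t0 r : R) (x y th : 'I_N -> R -> R), 0 <= t0 -> 0 <= r ->
  (forall t : R, t0 <= t -> forall i,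
    [/\ is_derive t 1 (x i) (- kv * Hf (x ^~ t) i + w t * y i t
                             - (yt t + y i t) * (kw * Hf (th ^~ t) i)),
        is_derive t 1 (y i) (- w t * x i t
                             + (xt t + x i t) * (kw * Hf (th ^~ t) i)) &
        is_derive t 1 (th i) (- kw * Hf (th ^~ t) i)]) ->
  \sum_i (x i t0 ^+ 2 + y i t0 ^+ 2 + th i t0 ^+ 2) <= r ^+ 2 ->
  forall t, t0 <= t ->
  \sum_i (x i t ^+ 2 + y i t ^+ 2 + th i t ^+ 2) <=
    A * (r ^+ 2 + r) * expR (B * r) * expR (- (2 * C) * (t - t0))].
Proof.
have [BH BH0 HB] := H_bounded.
have [pm pm0 pmP] := pos_lower_bound p0; have [pM pM0 pMP] := pos_upper_bound p.
pose P := \sum_i p i; have P0 : 0 <= P by apply: sumr_ge0 => i _; exact: ltW.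
pose gam := kw * h; have gam0 : 0 < gam by exact: mulr_gt0.
(* Total coefficient of the [x] terms to be dominated: two from the pointwise estimate, one from the
   square of [H x], and a last one so that dissipation at rate [w ^+ 4 / 2] remains in [x]. *)
pose lam1 := 9 * W ^+ 2 + W ^+ 4 + kv ^+ 2 * W ^+ 2 * BH + W ^+ 4 / 2.
have W2 : 0 < W ^+ 2 by exact: exprn_gt0.
have W3 : 0 < W ^+ 3 by exact: exprn_gt0.
have W4 : 0 < W ^+ 4 by exact: exprn_gt0.
have kv2 : 0 < kv ^+ 2 by exact: exprn_gt0.
have lam10 : 0 < lam1 by rewrite /lam1 !addr_gt0 ?mulr_gt0.
(* The first two summands make [U] comparable to [X + Y]; the third makes the dissipation in [x]
   exceed [lam1]. *)
pose lam := 1 + W ^+ 3 + lam1 / (2 * kv * h).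
have kvh : 0 < 2 * kv * h by rewrite !mulr_gt0.
have lam0 : 0 < lam by rewrite /lam !addr_gt0 ?divr_gt0.
have lamW : 1 + W ^+ 3 / 2 <= lam.
  by have := divr_gt0 lam10 kvh; rewrite /lam; lra.
have lamh : lam1 <= 2 * lam * kv * h.
  have -> : 2 * lam * kv * h = (1 + W ^+ 3) * (2 * kv * h) + lam1.
    by rewrite /lam; field; rewrite !gt_eqF.
  by rewrite lerDr mulr_ge0// ?(ltW kvh)// addr_ge0// ltW.
pose K1 := (2 * lam + W ^+ 3) * M2 + W ^+ 3.
have K10 : 0 < K1 by rewrite /K1 addr_gt0// mulr_gt0// addr_gt0// mulr_gt0.
(* Only [K ^+ 2] has to dominate the fraction, and the square of [1 + z] exceeds [z] for [z >= 0],
   so no square root is taken. *)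
pose K := 1 + kw ^+ 2 * BH * pM / pm.
have Kp0 : 0 < kw ^+ 2 * BH * pM / pm by rewrite divr_gt0// !mulr_gt0.
have K0 : 0 < K by rewrite /K addr_gt0.
have K2 : kw ^+ 2 * BH * pM / pm <= K ^+ 2.
  by rewrite /K sqrrD; have := sqr_ge0 (kw ^+ 2 * BH * pM / pm); lra.
pose kap := K * K1 * (1 + P).
have kap0 : 0 < kap by rewrite !mulr_gt0// ltr_wpDr.
(* [a] is the guaranteed mean of [w ^+ 2] over a window. The reciprocal of a sum makes [c] meet two
   demands: [c <= 1 / (4 lam)], so that the dissipation dominates [c * w ^+ 4 * U], and
   [c * W ^+ 4 <= gam / 2], as the Gronwall lemma requires. *)
pose a := mu / T; have a0 : 0 < a by exact: divr_gt0.
pose c := (4 * lam + 2 * W ^+ 4 / gam)^-1.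
have c1 : 0 < 4 * lam + 2 * W ^+ 4 / gam by rewrite addr_gt0 ?divr_gt0 ?mulr_gt0.
have c0 : 0 < c by rewrite invr_gt0.
have clam : c <= (4 * lam)^-1.
  rewrite lef_pV2 ?posrE// ?mulr_gt0// lerDl divr_ge0 ?(ltW gam0)// mulr_ge0//.
  exact: ltW.
have cW : c * W ^+ 4 <= gam / 2.
  have : c <= (2 * W ^+ 4 / gam)^-1.
    rewrite lef_pV2 ?posrE// ?divr_gt0 ?mulr_gt0//.
    by rewrite lerDr mulr_ge0// ltW.
  rewrite -(ler_pM2r W4) => /le_trans; apply.
  by rewrite le_eqVlt; apply/orP; left; apply/eqP; field; rewrite !gt_eqF.
have Sn (u v : 'I_N -> R) : dot u u + dot v v = \sum_i p i * (u i ^+ 2 + v i ^+ 2).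
  by rewrite /wdot -big_split; apply: eq_bigr => i _ /=; ring.
(* The slower of the decay rates of [U] and of the weighted square of [theta], halved for the
   norm. *)
pose C := Num.min (c * a ^+ 2) (2 * gam) / 2.
have C0 : 0 < C.
  rewrite divr_gt0// lt_min; apply/andP; split; first by rewrite mulr_gt0 ?exprn_gt0.
  exact: mulr_gt0.
(* The first summand comes from [U t0], of order [r ^+ 2], the second from the source, of order [r];
   this explains the factor [r ^+ 2 + r]. In [A] the exponential is the loss from the incomplete
   window, and the added [pM] accounts for [theta]. *)
pose A1 := 2 * lam * pM + 2 * kap / gam.
have A10 : 0 < A1.
  by apply: addr_gt0; [do !apply: mulr_gt0|apply: divr_gt0 => //; exact: mulr_gt0].
pose A := (A1 * expR (2 * c * a * mu) + pM) / pm.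
have A0 : 0 < A.
  by apply: divr_gt0 => //; apply: addr_gt0 => //; apply: mulr_gt0 => //; exact: expR_gt0.
exists A, (kap / gam), C; split=> //; first exact: divr_gt0.
move=> t0 r x y th t00 r0 dxy init t tt0.
pose X s := dot (x ^~ s) (x ^~ s); pose Y s := dot (y ^~ s) (y ^~ s).
pose Th s := dot (th ^~ s) (th ^~ s).
have X0 s : 0 <= X s by exact: S_ge0.
have Y0 s : 0 <= Y s by exact: S_ge0.
have XYTh : X t0 + Y t0 + Th t0 <= pM * r ^+ 2.
  apply: le_trans (_ : pM * (\sum_i (x i t0 ^+ 2 + y i t0 ^+ 2 + th i t0 ^+ 2)) <= _).
    rewrite /X /Y /Th Sn /wdot -big_split/= mulr_sumr; apply: ler_sum => i _.
    rewrite -expr2 -mulrDr ler_wpM2r//.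
    by rewrite !addr_ge0 ?sqr_ge0.
  by rewrite ler_pM2l.
have Th0 : 0 <= Th t0 by exact: S_ge0.
have Thd s : t0 <= s -> Th s <= pM * r ^+ 2 * expR (- (2 * gam * (s - t0))).
  have dth u (u0 : t0 <= u) i : is_derive u 1 (th i) (- kw * Hf (th ^~ u) i).
    by case: (dxy u u0 i).
  move=> s0; apply: le_trans (wdot_decay dth s0) _; rewrite ler_wpM2r ?expR_ge0//.
  by have := X0 t0; have := Y0 t0; move: XYTh; rewrite /Th; lra.
pose rho s := K * r * expR (- gam * (s - t0)).
have rho0 s : 0 <= rho s by rewrite !mulr_ge0 ?expR_ge0// ltW.
have q_le s i : t0 <= s -> `|kw * Hf (th ^~ s) i| <= rho s.
  move=> s0; apply: sqr_le_norm => //.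
  have e2 : expR (- gam * (s - t0)) ^+ 2 = expR (- (2 * gam * (s - t0))).
    by rewrite -expRM_natl; congr expR; ring.
  rewrite /rho !exprMn e2.
  have pi_le : pm * Hf (th ^~ s) i ^+ 2 <=
      BH * (pM * r ^+ 2 * expR (- (2 * gam * (s - t0)))).
    apply: le_trans (_ : _ <= dot (Hf (th ^~ s)) (Hf (th ^~ s))) _.
      rewrite /wdot (bigD1 i)//= -expr2 -[leLHS]addr0 lerD//.
        by rewrite ler_wpM2r ?sqr_ge0.
      by apply: sumr_ge0 => j _; rewrite mulr_ge0 ?(ltW (p0 _))// -expr2 sqr_ge0.
    by apply: le_trans (HB _) _; rewrite ler_pM2l// Thd.
  have kw2 : 0 < kw ^+ 2 by exact: exprn_gt0.
  have E0 : 0 <= r ^+ 2 * expR (- (2 * gam * (s - t0))).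
    by rewrite mulr_ge0 ?expR_ge0 ?sqr_ge0.
  apply: le_trans (_ : kw ^+ 2 * BH * pM / pm *
    (r ^+ 2 * expR (- (2 * gam * (s - t0)))) <= _).
    have hh : Hf (th ^~ s) i ^+ 2 <=
        BH * pM / pm * (r ^+ 2 * expR (- (2 * gam * (s - t0)))).
      rewrite -(ler_pM2l pm0); apply: le_trans pi_le _.
      by rewrite le_eqVlt; apply/orP; left; apply/eqP; field; rewrite gt_eqF.
    have -> : kw ^+ 2 * BH * pM / pm * (r ^+ 2 * expR (- (2 * gam * (s - t0)))) =
      kw ^+ 2 * (BH * pM / pm * (r ^+ 2 * expR (- (2 * gam * (s - t0))))) by rewrite !mulrA.
    by apply: ler_wpM2l => //; exact: ltW.
  by rewrite -[leRHS]mulrA; apply: ler_wpM2r.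
pose f i s := p i * (lam * (x i s * x i s + y i s * y i s) - w s ^+ 3 * (x i s * y i s)).
pose U s := \sum_i f i s.
pose dx i s := - kv * Hf (x ^~ s) i + w s * y i s - (yt s + y i s) * (kw * Hf (th ^~ s) i).
pose dy i s := - w s * x i s + (xt s + x i s) * (kw * Hf (th ^~ s) i).
pose dU s := \sum_i p i * (lam * (2 * (x i s * dx i s) + 2 * (y i s * dy i s))
    - (3 * w s ^+ 2 * dw s * (x i s * y i s) + w s ^+ 3 * (dx i s * y i s + x i s * dy i s))).
have s_ge0 s : t0 <= s -> 0 <= s by exact: le_trans.
have U_derive s : t0 <= s -> is_derive s 1 U (dU s).
  move=> s0; apply: is_derive_bigsum => i; rewrite /f.
  have [d1 d2 _] := dxy s s0 i; have d3 := w_derive (s_ge0 s s0).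
  exact: is_derive_lyapunov.
have Ulow s : t0 <= s -> X s + Y s <= U s.
  move=> s0; rewrite /X /Y Sn /U; apply: ler_sum => i _; rewrite ler_pM2l// -!expr2.
  have := coupling_bound (x i s) (y i s) (w_le (s_ge0 s s0)).
  rewrite ler_norml => /andP[_].
  have := ler_wpM2r (addr_ge0 (sqr_ge0 (x i s)) (sqr_ge0 (y i s))) lamW.
  by set a1 := W ^+ 3 / 2 * _; set a2 := lam * _; rewrite mulrDl mul1r -/a1; lra.
have Uup s : t0 <= s -> U s <= 2 * lam * (X s + Y s).
  move=> s0; rewrite /X /Y Sn /U mulr_sumr; apply: ler_sum => i _.
  rewrite mulrCA ler_pM2l// -!expr2.
  have := coupling_bound (x i s) (y i s) (w_le (s_ge0 s s0)).
  rewrite ler_norml => /andP[+ _].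
  have xy0 := addr_ge0 (sqr_ge0 (x i s)) (sqr_ge0 (y i s)).
  have := ler_wpM2r xy0 lamW.
  rewrite -[2 * lam * _]mulrA.
  by set a1 := W ^+ 3 / 2 * _; set a2 := lam * _; rewrite mulrDl mul1r -/a1; lra.
have U0 s : t0 <= s -> 0 <= U s.
  by move=> s0; apply: le_trans (Ulow s s0); exact: addr_ge0.
(* Weighted sum of the pointwise estimates. The constant 1 in each of them sums to [P], and
   coercivity of [H] absorbs all the positive [x] terms. *)
have dU_le s : t0 <= s -> dU s <= - (w s ^+ 4 / 2) * (X s + Y s)
    + rho s * K1 * (X s + Y s + P).
  move=> s0.
  have w4 : w s ^+ 4 <= W ^+ 4.
    by have := expr_norm_le 4 (w_le (s_ge0 s s0)); rewrite ger0_norm ?exprn_even_ge0.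
  apply: le_trans (_ : _ <= - (2 * lam * kv) * dot (x ^~ s) (Hf (x ^~ s))
    + (9 * W ^+ 2 + W ^+ 4) * X s
    + kv ^+ 2 * W ^+ 2 * dot (Hf (x ^~ s)) (Hf (x ^~ s))
    - w s ^+ 4 / 2 * Y s + rho s * K1 * (X s + Y s + P)) _.
    rewrite /X /Y Sn -big_split/= /wdot.
    rewrite -!mulNr !mulr_sumr -!big_split/=; apply: ler_sum => i _.
    have := lyapunov_derivative_pointwise (ltW lam0) (w_le (s_ge0 s s0))
      (dw_le (s_ge0 s s0)) (xt_le (s_ge0 s s0)) (yt_le (s_ge0 s s0)) (q_le s i s0)
      (erefl (dx i s)) (erefl (dy i s)).
    rewrite -/K1 => HL; apply: le_trans (ler_wpM2l (ltW (p0 i)) HL) _.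
    rewrite le_eqVlt; apply/orP; left; apply/eqP.
    move: (x i s) (y i s) (w s) (Hf (x ^~ s) i) (p i) (rho s) (K1); clear => *.
    ring.
  rewrite lerD2r.
  have F1 : lam1 * X s <= 2 * lam * kv * dot (x ^~ s) (Hf (x ^~ s)).
    apply: le_trans (_ : 2 * lam * kv * h * X s <= _); first exact: ler_wpM2r.
    rewrite -[leLHS]mulrA; apply: ler_wpM2l => //.
      by apply/ltW; do !apply: mulr_gt0.
    exact: H_coercive.
  have F2 : kv ^+ 2 * W ^+ 2 * dot (Hf (x ^~ s)) (Hf (x ^~ s)) <=
            kv ^+ 2 * W ^+ 2 * BH * X s.
    rewrite -[leRHS]mulrA; apply: ler_wpM2l => //.
    by apply/ltW; exact: mulr_gt0.
  have F3 : w s ^+ 4 / 2 * X s <= W ^+ 4 / 2 * X s by rewrite ler_wpM2r// ler_pM2r.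
  move: F1 F2 F3; rewrite /lam1.
  move: (dot _ _) (dot _ _) (X s) (Y s) (w s) (lam) => *.
  lra.
(* [phi] is linear in [w ^+ 2], hence has an explicit primitive, and lies below
   [c * w ^+ 4]. *)
pose phi s := c * (2 * a * w s ^+ 2 - a ^+ 2).
pose Phi s := c * (2 * a * (g s - g t0) - a ^+ 2 * (s - t0)).
have phi_le s : phi s <= c * w s ^+ 4.
  by rewrite ler_pM2l//; have := sqr_ge0 (w s ^+ 2 - a); rewrite sqrrB -exprM; lra.
have Phi_derive s : t0 <= s -> is_derive s 1 Phi (phi s).
  move=> s0; have d := g_derive (s_ge0 s s0).
  by rewrite /Phi; apply: is_derive_eq; rewrite /GRing.scale/= /phi; ring.
have Phi_t0 : Phi t0 = 0 by rewrite /Phi !subrr !mulr0 subrr mulr0.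
have Phi_le s : t0 <= s -> Phi s <= gam / 2 * (s - t0).
  apply: (@le_of_derive_le _ t0 Phi (fun s => gam / 2 * (s - t0)) phi (fun=> gam / 2)) => //.
  - by move=> u _; apply: is_derive_eq; rewrite /GRing.scale/=; ring.
  - move=> u u0; apply: le_trans (phi_le u) (le_trans _ cW); rewrite ler_pM2l//.
    by have := expr_norm_le 4 (w_le (s_ge0 u u0)); rewrite ger0_norm ?exprn_even_ge0.
  - by rewrite Phi_t0 subrr mulr0.
(* As [mu / T = a], excitation makes [2 * a * g] grow at mean rate [2 * a ^+ 2], twice what [Phi]
   subtracts. *)
have Phi_ge : c * a ^+ 2 * (t - t0) - 2 * c * a * mu <= Phi t.
  have := excitation_growth T0 t00 tt0 g_mono g_growth (ltW mu0).
  rewrite -(ler_pM2l (mulr_gt0 (mulr_gt0 (ltr0n R 2) c0) a0)).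
  have -> : 2 * c * a * (mu * ((t - t0) / T - 1)) =
    2 * c * a ^+ 2 * (t - t0) - 2 * c * a * mu.
    by rewrite /a; field; rewrite gt_eqF.
  by rewrite /Phi; lra.
have kr0 : 0 <= kap * r by rewrite mulr_ge0// ltW.
have dU_gronwall s : t0 <= s -> dU s <= (- phi s + kap * r * expR (- gam * (s - t0))) * U s
    + kap * r * expR (- gam * (s - t0)).
  move=> s0; apply: le_trans (dU_le s s0) _.
  have G1 : phi s * U s <= w s ^+ 4 / 2 * (X s + Y s).
    apply: le_trans (_ : (4 * lam)^-1 * w s ^+ 4 * U s <= _).
      rewrite ler_wpM2r ?U0// (le_trans (phi_le s))// ler_wpM2r//.
      by rewrite exprn_even_ge0.
    have -> : w s ^+ 4 / 2 * (X s + Y s) =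
        (4 * lam)^-1 * w s ^+ 4 * (2 * lam * (X s + Y s)).
      by field; rewrite gt_eqF.
    rewrite ler_wpM2l ?Uup// mulr_ge0// ?exprn_even_ge0// invr_ge0 mulr_ge0//.
    exact: ltW.
  have G2 : rho s * K1 * (X s + Y s + P) <=
      kap * r * expR (- gam * (s - t0)) * (U s + 1).
    have -> : kap * r * expR (- gam * (s - t0)) * (U s + 1) =
      rho s * K1 * ((1 + P) * (U s + 1)) by rewrite /kap /rho; ring.
    apply: ler_wpM2l; first by apply: mulr_ge0 => //; exact: ltW.
    by have := Ulow s s0; have := mulr_ge0 P0 (U0 s s0); lra.
  move: G1 G2; move: (phi s) (U s) (X s) (Y s) (rho s * K1 * _) (kap * r * _) => *.
  by lra.
have UT := gronwall_decay gam0 kr0 U_derive Phi_derive U0 Phi_t0 Phi_le dU_gronwall tt0.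
pose Et := expR (- (2 * C) * (t - t0)).
have rr : 0 <= r ^+ 2 + r by rewrite addr_ge0 ?sqr_ge0.
have er : 1 <= expR (kap / gam * r).
  by rewrite -expR0 ler_expR mulr_ge0// divr_ge0 ?(ltW gam0) ?(ltW kap0).
have tt : 0 <= t - t0 by rewrite subr_ge0.
have XYle : X t + Y t <= A1 * (r ^+ 2 + r) * expR (kap / gam * r) *
    (expR (2 * c * a * mu) * Et).
  apply: le_trans (Ulow t tt0) (le_trans UT _).
  rewrite (_ : kap * r / gam = kap / gam * r); last by rewrite mulrAC.
  apply: ler_pM; rewrite ?expR_ge0//.
  - rewrite mulr_ge0 ?expR_ge0// addr_ge0 ?U0//.
    by rewrite divr_ge0 ?(ltW gam0)// mulr_ge0.
  - rewrite ler_pM2r ?expR_gt0//.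
    have V1 : U t0 <= 2 * lam * pM * r ^+ 2.
      apply: le_trans (Uup t0 (lexx _)) _; rewrite -[leRHS]mulrA; apply: ler_wpM2l.
        by apply: mulr_ge0 => //; exact: ltW.
      by move: XYTh; lra.
    have V2 : 0 <= 2 * lam * pM * r by rewrite !mulr_ge0 ?(ltW lam0) ?(ltW pM0).
    have V3 : 0 <= 2 * kap / gam * r ^+ 2.
      apply: mulr_ge0 (sqr_ge0 _); apply: divr_ge0 (ltW gam0).
      by apply: mulr_ge0 => //; exact: ltW.
    have -> : 2 * (kap * r) / gam = 2 * kap / gam * r by ring.
    rewrite /A1; move: V1 V2 V3; move: (2 * lam * pM) (2 * kap / gam) (U t0) => *.
    by lra.
  - rewrite /Et -expRD ler_expR.
    have : 2 * C * (t - t0) <= c * a ^+ 2 * (t - t0).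
      by rewrite ler_wpM2r// /C mulrC divfK// ge_min lexx.
    by move: Phi_ge; lra.
have Thle : Th t <= pM * (r ^+ 2 + r) * expR (kap / gam * r) * Et.
  apply: le_trans (Thd t tt0) _.
  have : expR (- (2 * gam * (t - t0))) <= Et.
    rewrite /Et ler_expR mulNr lerN2 ler_wpM2r// /C mulrC divfK// ge_min lexx orbT.
    by [].
  move=> EE; apply: ler_pM; rewrite ?expR_ge0//.
    by rewrite mulr_ge0 ?sqr_ge0// ltW.
  rewrite -[leLHS]mulr1; apply: ler_pM => //.
    by rewrite mulr_ge0 ?sqr_ge0// ltW.
  by rewrite ler_pM2l// lerDl.
have fin : pm * \sum_i (x i t ^+ 2 + y i t ^+ 2 + th i t ^+ 2) <= X t + Y t + Th t.
  rewrite /X /Y /Th Sn /wdot -big_split/= mulr_sumr; apply: ler_sum => i _.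
  by rewrite -expr2 -mulrDr ler_wpM2r// !addr_ge0 ?sqr_ge0.
rewrite -(ler_pM2l pm0); apply: le_trans fin (le_trans (lerD XYle Thle) _).
rewrite -/Et le_eqVlt; apply/orP; left; apply/eqP.
by rewrite /A; field; rewrite gt_eqF.
Qed.

End Tracking.

(** * Existence of solutions *)
Section Existence.
Context {R : realType} {N : nat}.
Variables (H : 'M[R]_N).

Lemma continuous_mulv (u : 'I_N -> R -> R) i (t : R) :
  (forall j, {for t, continuous (u j)}) ->
  {for t, continuous (fun s => mulv H (u ^~ s) i)}.
Proof.
move=> cu; rewrite /mulv.
have -> : (fun s => \sum_j H i j * u j s) = \sum_j (fun s => H i j * u j s).
  by apply/funext => s; rewrite fct_sumE.
elim/big_ind : _ => [|f g cf cg|j _].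
- exact: cst_continuous.
- by apply: continuousD; [exact: cf|exact: cg].
- by apply: continuousM; [exact: cst_continuous|exact: cu].
Qed.

Lemma mulv_bound : exists2 B, 0 < B & forall (u : 'I_N -> R) D,
  0 <= D -> (forall i, `|u i| <= D) -> forall i, `|mulv H u i| <= B * D.
Proof.
have [B B0 HB] := pos_upper_bound (fun i => \sum_j `|H i j|).
exists B => // u D D0 uD i; rewrite /mulv (le_trans (ler_norm_sum _ _ _))//.
apply: le_trans (_ : \sum_j `|H i j| * D <= _).
  by apply: ler_sum => j _; rewrite normrM ler_wpM2l.
by rewrite -mulr_suml ler_wpM2r.
Qed.

Lemma mulvB (u v : 'I_N -> R) i :
  mulv H u i - mulv H v i = mulv H (fun j => u j - v j) i.
Proof. by rewrite /mulv -sumrB; apply: eq_bigr => j _; rewrite mulrBr. Qed.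

Lemma exists_theta (kw t0 : R) (u0 : 'I_N -> R) : 0 < kw ->
  exists th : 'I_N -> R -> R, forall i, th i t0 = u0 i /\
    forall t, t0 <= t -> is_derive t 1 (th i) (- kw * mulv H (th ^~ t) i).
Proof.
move=> kw0; have [B B0 HB] := mulv_bound.
have [U U0 HU] := pos_upper_bound (fun i => `|u0 i|).
have kB : 0 < kw * B by exact: mulr_gt0.
apply: (@picard_global R 'I_N (fun _ u i => - kw * mulv H u i) t0 u0 (kw * B)
  (kw * B * U)) => //.
- by rewrite mulr_ge0// ltW.
- move=> _ u v D uvD i; rewrite -mulrBr mulvB normrM normrN (gtr0_norm kw0) -mulrA.
  rewrite ler_pM2l//; apply: HB => //.
  exact: le_trans (uvD i).
- by move=> u cu i t; apply: cvgM; [exact: cvg_cst|apply: continuous_mulv => j; exact: cu].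
- move=> _ i; rewrite normrM normrN (gtr0_norm kw0) -mulrA ler_pM2l//.
  by apply: HB => //; exact: ltW.
Qed.

Lemma exists_xy (kv t0 W M2 Q : R) (w xt yt : R -> R) (q : 'I_N -> R -> R)
    (x0 y0 : 'I_N -> R) :
  0 < kv -> 0 < W -> 0 < M2 -> 0 < Q ->
  (forall t : R, t0 <= t -> `|w t| <= W) ->
  (forall t : R, t0 <= t -> `|xt t| <= M2) ->
  (forall t : R, t0 <= t -> `|yt t| <= M2) ->
  (forall t : R, t0 <= t -> forall i, `|q i t| <= Q) ->
  (forall t, t0 <= t -> {for t, continuous w}) ->
  (forall t, t0 <= t -> {for t, continuous xt}) ->
  (forall t, t0 <= t -> {for t, continuous yt}) ->
  (forall t, t0 <= t -> forall i, {for t, continuous (q i)}) ->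
  exists x y : 'I_N -> R -> R, forall i, [/\ x i t0 = x0 i, y i t0 = y0 i &
    forall t, t0 <= t ->
      is_derive t 1 (x i)
        (- kv * mulv H (x ^~ t) i + w t * y i t - (yt t + y i t) * q i t) /\
      is_derive t 1 (y i) (- w t * x i t + (xt t + x i t) * q i t)].
Proof.
move=> kv0 W0 M20 Q0 wW xtM ytM qQ cw cxt cyt cq.
have [B B0 HB] := mulv_bound.
(* The coefficients are controlled only from [t0] on, so time is frozen before. In the index set of
   [F], [false] marks [x] and [true] marks [y]. *)
pose m t := Num.max t0 t.
have mt t : t0 <= m t by rewrite le_max lexx.
pose F t (u : bool * 'I_N -> R) (k : bool * 'I_N) : R := let: (b, i) := k in
  if b then - w (m t) * u (false, i) + (xt (m t) + u (false, i)) * q i (m t)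
  else - kv * mulv H (fun j => u (false, j)) i + w (m t) * u (true, i)
       - (yt (m t) + u (true, i)) * q i (m t).
pose L := kv * B + W + Q.
have L0 : 0 < L by rewrite !addr_gt0 ?mulr_gt0.
have FL t u v D : (forall k, `|u k - v k| <= D) -> forall k, `|F t u k - F t v k| <= L * D.
  move=> uvD [b i]; have D0 : 0 <= D by exact: le_trans (uvD (b, i)).
  have wD k : `|w (m t) * (u k - v k)| <= W * D by rewrite normrM ler_pM// wW.
  have qD k : `|q i (m t) * (u k - v k)| <= Q * D by rewrite normrM ler_pM// qQ.
  case: b => /=.
    rewrite (_ : _ - _ = - (w (m t) * (u (false, i) - v (false, i))) +
                         q i (m t) * (u (false, i) - v (false, i))); last by ring.
    rewrite (le_trans (ler_normD _ _))// normrN (le_trans (lerD (wD _) (qD _)))//.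
    by rewrite -mulrDl ler_wpM2r// /L -addrA lerDr mulr_ge0// ltW.
  rewrite (_ : _ - _ = - kv *
       (mulv H (fun j => u (false, j)) i - mulv H (fun j => v (false, j)) i)
     + w (m t) * (u (true, i) - v (true, i))
     - q i (m t) * (u (true, i) - v (true, i))); last by ring.
  rewrite mulvB (le_trans (ler_normB _ _))// /L mulrDl lerD//.
  rewrite (le_trans (ler_normD _ _))// mulrDl lerD//.
  rewrite normrM normrN (gtr0_norm kv0) -mulrA ler_pM2l//.
  by apply: HB => // j; exact: uvD.
pose u0 (k : bool * 'I_N) := if k.1 then y0 k.2 else x0 k.2.
have [U U0 HU] := pos_upper_bound (fun k => `|u0 k|).
have cm (f : R -> R) : (forall t, t0 <= t -> {for t, continuous f}) ->
    continuous (fun t => f (m t)) by exact: continuous_maxl.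
have [u uP] : exists u : bool * 'I_N -> R -> R, forall k, u k t0 = u0 k /\
    forall t, t0 <= t -> is_derive t 1 (u k) (F t (u ^~ t) k).
  apply: (@picard_global R _ F t0 u0 L (L * U + M2 * Q)) => //.
  - by rewrite addr_ge0// mulr_ge0// ltW.
  - move=> v cv [b i] t.
    have cqm : continuous (fun t => q i (m t)) by apply: cm => s ts; exact: cq.
    have cwm := cm w cw; have cxm := cm xt cxt; have cym := cm yt cyt.
    case: b; rewrite /F.
      apply: cvgD; apply: cvgM; [apply: cvgN; exact: cwm|exact: cv| |exact: cqm].
      by apply: cvgD; [exact: cxm|exact: cv].
    apply: cvgB; [apply: cvgD|]; apply: cvgM.
    + exact: cvg_cst.
    + by apply: continuous_mulv => j; exact: cv.
    + exact: cwm.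
    + exact: cv.
    + by apply: cvgD; [exact: cym|exact: cv].
    + exact: cqm.
  - move=> t k.
    (* The Lipschitz bound compares [u0] with the zero state, where only the forcing by the leader
       coordinates remains, at most [M2 * Q]. *)
    rewrite -[F t u0 k](subrK (F t (fun=> 0) k)) (le_trans (ler_normD _ _))// lerD//.
      by apply: FL => j; rewrite subr0.
    case: k => -[] i /=.
      by rewrite mulr0 add0r addr0 normrM ler_pM ?xtM ?qQ.
    rewrite mulr0 addr0 addr0 [mulv _ _ _]big1 => [|j _]; last by rewrite mulr0.
    by rewrite mulr0 add0r normrN normrM ler_pM ?ytM ?qQ.
exists (fun i => u (false, i)), (fun i => u (true, i)) => i.
have [x0E dx] := uP (false, i); have [y0E dy] := uP (true, i).
split=> // t tt0; have := dx t tt0; have := dy t tt0.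
by rewrite /= /m (max_idPr tt0).
Qed.

End Existence.

(** * Block coordinates of the state vector *)

Section Assembly.
Context {R : realType} {N : nat}.
Implicit Types (z : 'cV[R]_(N + N + N)) (i : 'I_N).

Definition xpart z i := z (lshift N (lshift N i)) 0.
Definition ypart z i := z (lshift N (rshift N i)) 0.
Definition thpart z i := z (rshift (N + N) i) 0.

Lemma enorm_sqr z :
  enorm z ^+ 2 = \sum_i (xpart z i ^+ 2 + ypart z i ^+ 2 + thpart z i ^+ 2).
Proof.
rewrite /enorm sqr_sqrtr; last by apply: sumr_ge0 => i _; exact: sqr_ge0.
by rewrite !big_split_ord /= !big_split.
Qed.

Lemma error_systemE (kw kv : R) (H : 'M[R]_N) (w xt yt : R -> R) t z i :
  [/\ xpart (error_system kw kv H w xt yt t z) i =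
        - kv * mulv H (xpart z) i + w t * ypart z i
        - (yt t + ypart z i) * (kw * mulv H (thpart z) i),
      ypart (error_system kw kv H w xt yt t z) i =
        - w t * xpart z i + (xt t + xpart z i) * (kw * mulv H (thpart z) i) &
      thpart (error_system kw kv H w xt yt t z) i = - kw * mulv H (thpart z) i].
Proof.
have HE (v : 'cV[R]_N) (f : 'I_N -> R) k : (forall j, v j 0 = f j) ->
    (H *m v) k 0 = mulv H f k.
  by move=> vf; rewrite mxE; apply: eq_bigr => j _; rewrite vf.
have xE j : usubmx (usubmx z) j 0 = xpart z j by rewrite !mxE.
have yE j : dsubmx (usubmx z) j 0 = ypart z j by rewrite !mxE.
have thE j : dsubmx z j 0 = thpart z j by rewrite !mxE.
have addE (A B : 'cV[R]_N) k : (A + B) k 0 = A k 0 + B k 0 by rewrite mxE.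
have oppE (A : 'cV[R]_N) k : (- A) k 0 = - A k 0 by rewrite mxE.
have sclE b (A : 'cV[R]_N) k : (b *: A) k 0 = b * A k 0 by rewrite mxE.
have diagE (A B : 'cV[R]_N) k :
    (cdiag A *m H *m B) k 0 = A k 0 * (H *m B) k 0.
  by rewrite -mulmxA mul_diag_mx mxE [A^T _ _]mxE.
have xcol (A B C : 'cV[R]_N) k : xpart (col_mx (col_mx A B) C) k = A k 0.
  by rewrite /xpart !col_mxEu.
have ycol (A B C : 'cV[R]_N) k : ypart (col_mx (col_mx A B) C) k = B k 0.
  by rewrite /ypart col_mxEu col_mxEd.
have thcol (A B C : 'cV[R]_N) k : thpart (col_mx (col_mx A B) C) k = C k 0.
  by rewrite /thpart col_mxEd.
by split; rewrite /error_system ?(xcol, ycol, thcol) !(addE, oppE, sclE, diagE)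
  ?(HE _ _ _ xE) ?(HE _ _ _ thE) ?xE ?yE; ring.
Qed.

Lemma part_inj (z z' : 'cV[R]_(N + N + N)) : (forall i, xpart z i = xpart z' i) ->
  (forall i, ypart z i = ypart z' i) -> (forall i, thpart z i = thpart z' i) -> z = z'.
Proof.
move=> xx yy tt; apply/matrixP => k j; rewrite ord1.
case: (split_ordP k) => [k' ->|i ->]; last exact: tt.
by case: (split_ordP k') => i ->; [exact: xx|exact: yy].
Qed.

End Assembly.

Section Main.
Context {R : realType} {N : nat}.
Variables (kw kv : R) (H : 'M[R]_N) (omega0 xt yt : R -> R).
Local Notation sys := (error_system kw kv H omega0 xt yt).

(** A solution is only differentiable from the right at [t0], so its coordinates are replaced by
    two-sided extensions that agree with it from [t0] on. *)
Lemma solution_parts_derive (t0 : R) z0 z : is_solution sys t0 z0 z ->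
  exists x y th : 'I_N -> R -> R,
    (forall t, t0 <= t -> [/\ x ^~ t = xpart (z t), y ^~ t = ypart (z t) &
                              th ^~ t = thpart (z t)]) /\
    (forall t, t0 <= t -> forall i,
      [/\ is_derive t 1 (x i) (- kv * mulv H (x ^~ t) i + omega0 t * y i t
                               - (yt t + y i t) * (kw * mulv H (th ^~ t) i)),
          is_derive t 1 (y i) (- omega0 t * x i t
                               + (xt t + x i t) * (kw * mulv H (th ^~ t) i)) &
          is_derive t 1 (th i) (- kw * mulv H (th ^~ t) i)]).
Proof.
move=> [_ dz].
have /choice[zh zhP] k : exists g : R -> R, (forall t, t0 <= t -> g t = z t k 0) /\
    (forall t, t0 <= t -> is_derive t 1 g (sys t (z t) k 0)).
  by apply: is_derive_extension => t tt0; exact: dz.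
exists (fun i => zh (lshift N (lshift N i))), (fun i => zh (lshift N (rshift N i))),
  (fun i => zh (rshift (N + N) i)).
have parts t : t0 <= t -> [/\
    (fun i => zh (lshift N (lshift N i)) t) = xpart (z t),
    (fun i => zh (lshift N (rshift N i)) t) = ypart (z t) &
    (fun i => zh (rshift (N + N) i) t) = thpart (z t)].
  by move=> tt0; split; apply/funext => i; apply: (zhP _).1.
split=> // t tt0 i; have [Ex Ey Eth] := parts t tt0.
have [d1 d2 d3] := error_systemE kw kv H omega0 xt yt t (z t) i.
rewrite Ex Eth -/(xpart (z t) i).
have -> : zh (lshift N (lshift N i)) t = xpart (z t) i by exact: (zhP _).1.
have -> : zh (lshift N (rshift N i)) t = ypart (z t) i by exact: (zhP _).1.
by rewrite -d1 -d2 -d3; split; apply: (zhP _).2.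
Qed.

Lemma solution_of_parts (t0 : R) z0 (x y th : 'I_N -> R -> R) :
  (forall i, x i t0 = xpart z0 i) -> (forall i, y i t0 = ypart z0 i) ->
  (forall i, th i t0 = thpart z0 i) ->
  (forall t, t0 <= t -> forall i,
      [/\ is_derive t 1 (x i) (- kv * mulv H (x ^~ t) i + omega0 t * y i t
                               - (yt t + y i t) * (kw * mulv H (th ^~ t) i)),
          is_derive t 1 (y i) (- omega0 t * x i t
                               + (xt t + x i t) * (kw * mulv H (th ^~ t) i)) &
          is_derive t 1 (th i) (- kw * mulv H (th ^~ t) i)]) ->
  exists z, is_solution sys t0 z0 z.
Proof.
move=> x0E y0E th0E dxy.
pose z t : 'cV[R]_(N + N + N) :=
  col_mx (col_mx (\col_i x i t) (\col_i y i t)) (\col_i th i t).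
have zx t : xpart (z t) = x ^~ t by apply/funext => i; rewrite /xpart !col_mxEu mxE.
have zy t : ypart (z t) = y ^~ t.
  by apply/funext => i; rewrite /ypart col_mxEu col_mxEd mxE.
have zth t : thpart (z t) = th ^~ t by apply/funext => i; rewrite /thpart col_mxEd mxE.
exists z; split.
  by apply: part_inj => i; rewrite ?zx ?zy ?zth.
move=> t tt0 k; apply: is_derive_fromW.
case: (split_ordP k) => [k' ->|i ->]; last first.
- have [_ _ E] := error_systemE kw kv H omega0 xt yt t (z t) i.
  have [_ _ d] := dxy t tt0 i.
  rewrite -[sys t (z t) _ _]/(thpart (sys t (z t)) i) E zth.
  by have -> : (fun s => z s (rshift (N + N) i) 0) = th i
    by apply/funext => s; rewrite -[LHS]/(thpart (z s) i) zth.
case: (split_ordP k') => i ->.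
- have [E _ _] := error_systemE kw kv H omega0 xt yt t (z t) i.
  have [d _ _] := dxy t tt0 i.
  rewrite -[sys t (z t) _ _]/(xpart (sys t (z t)) i) E zx zy zth.
  by have -> : (fun s => z s (lshift N (lshift N i)) 0) = x i
    by apply/funext => s; rewrite -[LHS]/(xpart (z s) i) zx.
- have [_ E _] := error_systemE kw kv H omega0 xt yt t (z t) i.
  have [_ d _] := dxy t tt0 i.
  rewrite -[sys t (z t) _ _]/(ypart (sys t (z t)) i) E zx zth.
  by have -> : (fun s => z s (lshift N (rshift N i)) 0) = y i
    by apply/funext => s; rewrite -[LHS]/(ypart (z s) i) zy.
Qed.

End Main.

(** * The gain function and the signals of the leader *)

Section Assumptions.
Context {R : realType}.

(** The shape of the gain obtained from the square root of the estimate in [tracking_bound]. *)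
Lemma class_K_sqrt_exp (A B : R) : 0 < A -> 0 < B ->
  class_K (fun r => Num.sqrt (A * (r ^+ 2 + r)) * expR (B * r)).
Proof.
move=> A0 B0; split=> [||r s r0 rs].
- by rewrite expr0n add0r mulr0 sqrtr0 mul0r.
- apply: continuous_subspaceT => r; apply: cvgM; last first.
    apply: (continuous_comp (f := fun r => B * r)); last exact: continuous_expR.
    by apply: cvgM; [exact: cvg_cst|exact: cvg_id].
  apply: (@continuous_comp R R R (fun r => A * (r ^+ 2 + r)) Num.sqrt);
    last exact: sqrt_continuous.
  apply: cvgM; first exact: cvg_cst.
  by apply: cvgD; [exact: exprn_continuous|exact: cvg_id].
have s0 : 0 < s by exact: le_lt_trans rs.
have sq : r ^+ 2 < s ^+ 2 by rewrite ltr_pXn2r ?nnegrE// ltW.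
apply: ltr_pM; rewrite ?sqrtr_ge0 ?expR_ge0//.
  by rewrite ltr_sqrt ?mulr_gt0 ?addr_gt0 ?exprn_gt0// ltr_pM2l// ltrD.
by rewrite ltr_expR ltr_pM2l.
Qed.

(** Built from two-sided extensions of the leader trajectory, because the given functions may be
    discontinuous from the left at time 0. *)
Lemma leader_coordinates (v0 omega0 x0 y0 theta0 : R -> R) :
  leader_dynamics v0 omega0 x0 y0 theta0 -> bounded_position x0 y0 ->
  exists (M2 : R) (xt yt : R -> R), [/\ 0 < M2,
    forall t, 0 <= t -> xt t = xtilde x0 y0 theta0 t /\ yt t = ytilde x0 y0 theta0 t,
    forall t : R, 0 <= t -> `|xt t| <= M2 /\ `|yt t| <= M2 &
    forall t, 0 <= t -> {for t, continuous xt} /\ {for t, continuous yt}].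
Proof.
move=> dyn [M M0 xyM].
have fx t (t0 : 0 <= t) : is_derive_from 0 x0 t (v0 t * cos (theta0 t)).
  by case: (dyn t t0).
have fy t (t0 : 0 <= t) : is_derive_from 0 y0 t (v0 t * sin (theta0 t)).
  by case: (dyn t t0).
have fth t (t0 : 0 <= t) : is_derive_from 0 theta0 t (omega0 t) by case: (dyn t t0).
have [x [xE dx]] := is_derive_extension fx.
have [y [yE dy]] := is_derive_extension fy.
have [th [thE dth]] := is_derive_extension fth.
exists (M + M), (xtilde x y th), (ytilde x y th); split=> [|t t0|t t0|t t0].
- exact: addr_gt0.
- by rewrite /xtilde /ytilde !(xE, yE, thE).
- have [xM yM] := xyM t t0; rewrite /xtilde /ytilde !(xE, yE)//.
  have bnd (u v c d : R) : `|u| <= M -> `|v| <= M -> `|c| <= 1 -> `|d| <= 1 ->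
      `|u * c + v * d| <= M + M.
    move=> uM vM c1 d1; rewrite (le_trans (ler_normD _ _))// !normrM.
    by rewrite -[M in leRHS]mulr1 lerD// ler_pM.
  have c1 : `|cos (th t)| <= 1 by rewrite ler_norml cos_geN1 cos_le1.
  have s1 : `|sin (th t)| <= 1 by rewrite ler_norml sin_geN1 sin_le1.
  by split; apply: bnd; rewrite ?normrN.
- have cx := is_derive1_continuous (dx t t0).
  have cy := is_derive1_continuous (dy t t0).
  have cth := is_derive1_continuous (dth t t0).
  have cc : {for t, continuous (fun s => cos (th s))}.
    by apply: continuous_comp; [exact: cth|exact: continuous_cos].
  have cs : {for t, continuous (fun s => sin (th s))}.
    by apply: continuous_comp; [exact: cth|exact: continuous_sin].
  split; apply: cvgD; apply: cvgM; [exact: cx|exact: cc|exact: cy|exact: cs| |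
    exact: cs|exact: cy|exact: cc].
  by apply: cvgN; exact: cx.
Qed.

(** Replaces [omega0] by a two-sided extension and the integral condition by the growth of a
    primitive [g] of its square. *)
Lemma exciting_signal (omega0 : R -> R) : bounded_exciting omega0 ->
  exists (W T mu : R) (w dw g : R -> R),
  [/\ [/\ 0 < W, 0 < T & 0 < mu],
    forall t : R, 0 <= t -> [/\ w t = omega0 t, `|w t| <= W & `|dw t| <= W],
    forall t : R, 0 <= t -> is_derive t 1 w (dw t),
    forall t : R, 0 <= t -> is_derive t 1 g (w t ^+ 2) &
    forall t : R, 0 <= t -> mu <= g (t + T) - g t].
Proof.
move=> [[W W0 omegaW] [T [mu [T0 mu0 exc]]]].
have /choice[dw dwP] t : exists l, 0 <= t ->
    [/\ `|omega0 t| <= W, is_derive_from 0 omega0 t l & `|l| <= W].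
  have [t0|t0] := pselect (0 <= t); last by exists 0.
  by have [oW [l ol lW]] := omegaW t t0; exists l.
have fw t (t0 : 0 <= t) : is_derive_from 0 omega0 t (dw t) by case: (dwP t t0).
have [w [wE wd]] := is_derive_extension fw.
pose w2 s := w s ^+ 2.
have cw2 (t : R) : 0 <= t -> {for t, continuous w2}.
  move=> t0; apply: (continuous_comp (f := w) (g := fun x => x ^+ 2)).
    exact: is_derive1_continuous (wd t t0).
  exact: exprn_continuous.
pose g := antideriv 0 (fun s => w2 (Num.max 0 s)).
have dg (t : R) : 0 <= t -> is_derive t 1 g (w2 t).
  move=> t0; have := is_derive_antideriv (continuous_maxl cw2) t0.
  by rewrite (max_idPr t0).
exists W, T, mu, w, dw, g; split=> // t t0.
  by have [? _ ?] := dwP t t0; rewrite wE.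
rewrite -lee_fin; apply: le_trans (exc t t0) _.
have tT : t < t + T by rewrite ltrDl.
have dgt (s : R) : t <= s -> is_derive s 1 g (w2 s).
  by move=> ts; apply: dg; exact: le_trans ts.
have cgt (s : R) : t <= s -> {for s, continuous w2}.
  by move=> ts; apply: cw2; exact: le_trans ts.
rewrite -(integral_derive tT dgt cgt) le_eqVlt; apply/orP; left; apply/eqP.
apply: eq_integral => s; rewrite inE/= in_itv/= => /andP[ts _].
by rewrite /w2 wE// (le_trans t0).
Qed.

End Assumptions.

(** * Decay and existence for the closed-loop error system *)

Unset Implicit Arguments.

Theorem theorem2 (R : realType) (N : nat) (hN : (1 <= N)%N)
  (kw kv : R) (hkw : 0 < kw) (hkv : 0 < kv)
  (v0 omega0 x0 y0 theta0 : R -> R)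
  (hleader : leader_dynamics v0 omega0 x0 y0 theta0)
  (e : rel 'I_N.+1) (a : 'M[R]_(N, N.+1)) (ha : adapted_weights e a)
  (h1 : bounded_position x0 y0)
  (h2 : bounded_exciting omega0)
  (h3 : has_spanning_tree_rooted_at e ord0) :
  globally_K_exponentially_stable
    (error_system kw kv (Hmx a) omega0
       (xtilde x0 y0 theta0) (ytilde x0 y0 theta0)).
Proof.
have [M2 [xt [yt [M20 xytE xytM xytC]]]] := leader_coordinates hleader h1.
have [W [T [mu [w [dw [g [[W0 T0 mu0] wW wd dg gT]]]]]]] := exciting_signal h2.
have [p [h [p0 hp0 Hcoer]]] := Hmx_diagonal_lyapunov ha h3.
set H := Hmx a in Hcoer *.
have coer x : h * wdot p x x <= wdot p x (mulv H x).
  have colE i : (\col_j x j) i 0 = x i :> R by rewrite mxE.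
  have := Hcoer (\col_i x i); rewrite /wdot.
  under eq_bigr do rewrite colE.
  under [X in _ <= X -> _]eq_bigr => i _.
    rewrite colE [X in _ * (_ * X)]mxE.
    under eq_bigr do rewrite colE.
    over.
  exact.
have wL t (t0 : 0 <= t) : `|w t| <= W by case: (wW t t0).
have dwL t (t0 : 0 <= t) : `|dw t| <= W by case: (wW t t0).
have xtL t (t0 : 0 <= t) : `|xt t| <= M2 by case: (xytM t t0).
have ytL t (t0 : 0 <= t) : `|yt t| <= M2 by case: (xytM t t0).
have [A [B [C [A0 B0 C0 bound]]]] := tracking_bound p0 hp0 coer hkw hkv W0 M20 T0 mu0
  wL dwL xtL ytL wd dg gT.
(* Square root of the bound on the squared norm, which halves both exponents. *)
exists (fun r => Num.sqrt (A * (r ^+ 2 + r)) * expR (B / 2 * r)), C; split=> //.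
  by apply: class_K_sqrt_exp => //; exact: divr_gt0.
move=> t0 z0 t00; have nneg t : t0 <= t -> 0 <= t by exact: le_trans.
split; last first.
  move=> z zsol t tt0; have [zt0 _] := zsol.
  have [x [y [th [parts dxy]]]] := solution_parts_derive zsol.
  have r0 : 0 <= enorm z0 by exact: sqrtr_ge0.
  have dxy' (s : R) (ts : t0 <= s) i :
    [/\ is_derive s 1 (x i) (- kv * mulv H (x ^~ s) i + w s * y i s
                             - (yt s + y i s) * (kw * mulv H (th ^~ s) i)),
        is_derive s 1 (y i) (- w s * x i s
                             + (xt s + x i s) * (kw * mulv H (th ^~ s) i)) &
        is_derive s 1 (th i) (- kw * mulv H (th ^~ s) i)].
    have [-> _ _] := wW s (nneg s ts); have [-> ->] := xytE s (nneg s ts).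
    exact: dxy.
  have normE s : t0 <= s -> \sum_i (x i s ^+ 2 + y i s ^+ 2 + th i s ^+ 2) =
      enorm (z s) ^+ 2.
    by move=> ts; have [Ex Ey Eth] := parts s ts; rewrite enorm_sqr -Ex -Ey -Eth.
  have := bound t0 (enorm z0) x y th t00 r0 dxy' _ t tt0.
  rewrite !normE// zt0 lexx => /(_ isT) le2.
  rewrite -(@ler_pXn2r _ 2) ?nnegrE ?sqrtr_ge0 ?mulr_ge0 ?expR_ge0 ?sqrtr_ge0//.
  have Ar0 : 0 <= A * (enorm z0 ^+ 2 + enorm z0).
    by apply: mulr_ge0; [exact: ltW|apply: addr_ge0 => //; exact: sqr_ge0].
  rewrite !exprMn (sqr_sqrtr Ar0).
  have -> : expR (B / 2 * enorm z0) ^+ 2 = expR (B * enorm z0).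
    by rewrite -expRM_natl; congr expR; field.
  have -> : expR (- C * (t - t0)) ^+ 2 = expR (- (2 * C) * (t - t0)).
    by rewrite -expRM_natl; congr expR; ring.
  exact: le2.
(* Existence uses the cascade structure: [theta] is solved first and then enters the [(x, y)]
   equations as the known signal [q]. *)
have [th thP] := exists_theta H t0 (thpart z0) hkw.
have dth (t : R) (tt0 : t0 <= t) i : is_derive t 1 (th i) (- kw * mulv H (th ^~ t) i).
  by case: (thP i) => _; apply.
have [BH BH0 HB] := mulv_bound H.
(* The weighted square of [theta] never exceeds its initial value, and this bounds the coefficient
   [q] on the whole half line. *)
have [D D0 thD] : exists2 D, 0 < D & forall i t, t0 <= t -> `|th i t| <= D.
  pose S0 := wdot p (th ^~ t0) (th ^~ t0).
  have [D D0 HD] := pos_upper_bound (fun i => S0 / p i).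
  exists (1 + D) => [|i t tt0]; first exact: addr_gt0.
  have D1 : 0 <= 1 + D by rewrite addr_ge0// ltW.
  apply: sqr_le_norm => //; apply: le_trans (_ : D <= _); last first.
    by rewrite sqrrD; have := sqr_ge0 D; lra.
  apply: le_trans (HD i); rewrite ler_pdivlMr// mulrC.
  apply: le_trans (_ : wdot p (th ^~ t) (th ^~ t) <= _).
    rewrite /wdot (bigD1 i)//= -expr2 lerDl; apply: sumr_ge0 => j _.
    by rewrite mulr_ge0 ?(ltW (p0 _))// -expr2 sqr_ge0.
  apply: le_trans (wdot_decay p0 hp0 coer hkw dth tt0) _.
  rewrite ler_piMr//.
    by apply: sumr_ge0 => j _; rewrite mulr_ge0 ?(ltW (p0 _))// -expr2 sqr_ge0.
  rewrite -expR0 ler_expR oppr_le0 mulr_ge0 ?subr_ge0// mulr_ge0//.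
  by rewrite mulr_ge0// ltW.
pose q i t := kw * mulv H (th ^~ t) i.
have qQ t (tt0 : t0 <= t) i : `|q i t| <= kw * (BH * D).
  rewrite /q normrM (gtr0_norm hkw) ler_pM2l//; apply: HB; first exact: ltW.
  by move=> j; exact: thD.
have cq t (tt0 : t0 <= t) i : {for t, continuous (q i)}.
  apply: cvgM; first exact: cvg_cst.
  by apply: continuous_mulv => j; exact: is_derive1_continuous (dth t tt0 j).
have [x [y xyP]] := exists_xy H (q := q) (xpart z0) (ypart z0) hkv W0 M20
  (mulr_gt0 hkw (mulr_gt0 BH0 D0))
  (fun t tt0 => wL t (nneg t tt0)) (fun t tt0 => xtL t (nneg t tt0))
  (fun t tt0 => ytL t (nneg t tt0)) qQ
  (fun t tt0 => is_derive1_continuous (wd t (nneg t tt0)))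
  (fun t tt0 => (xytC t (nneg t tt0)).1) (fun t tt0 => (xytC t (nneg t tt0)).2) cq.
apply: (solution_of_parts (x := x) (y := y) (th := th)) => [i|i|i|t tt0 i].
- by case: (xyP i).
- by case: (xyP i).
- by case: (thP i).
have [_ _ /(_ t tt0)[dx dy]] := xyP i.
have [<- _ _] := wW t (nneg t tt0); have [<- <-] := xytE t (nneg t tt0).
by split=> //; exact: dth.
Qed.
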